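(* Let $P=\{p_1,\ldots,p_n\}$ be a finite poset, labelled so that $p_i<p_j$ implies $i<j$, and let $r\ge1$. Let $\mathbb F_\bullet$ be the graded minimal free resolution of $S/H_r(P)$. Then $F_0=S$, and for $i\ge1$ the symbols $f(\sigma;u_{\mathcal I})$ with $u_{\mathcal I}\in G(H_r(P))$, $\sigma\subset\operatorname{set}(u_{\mathcal I})$, $|\sigma|=i-1$, form a homogeneous basis of $F_i$. The chain map of $\mathbb F_\bullet$ is given by $$\partial(f(\sigma;u_{\mathcal I}))=\sum_{x_{mj}\in\sigma}(-1)^{\alpha(\sigma,x_{mj})}\bigl(x_{tj}\,f(\sigma\setminus\{x_{mj}\};u_{\mathcal I'})-x_{mj}\,f(\sigma\setminus\{x_{mj}\};u_{\mathcal I})\bigr)$$ if $\sigma\ne\emptyset$, and $\partial(f(\emptyset;u_{\mathcal I}))=u_{\mathcal I}$ otherwise. Here $\alpha(\sigma,x_{mj})=|\{x_{m'\ell'}\in\sigma : x_{m'\ell'}>x_{mj}\}|$, and for each $x_{mj}\in\sigma$ the integer $t$ and the multichain $\mathcal I'$ (both depending on $\mathcal I$ and $x_{mj}$) are as defined in the context.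
   Context: $K$ is a field and $S=K[x_{ij} : 1\le i\le r,\ 1\le j\le n]$ with variables ordered $x_{11}>x_{12}>\cdots>x_{1n}>x_{21}>\cdots>x_{2n}>\cdots>x_{r1}>\cdots>x_{rn}$. A poset ideal of $P$ is a down-closed subset (possibly empty). $\mathcal I_r(P)$ is the set of multichains $\mathcal I: I_1\subseteq\cdots\subseteq I_r=P$ of poset ideals; with $I_0=\emptyset$, put $u_{\mathcal I}=\prod_{j=1}^r\prod_{p_k\in I_j\setminus I_{j-1}}x_{jk}$. $H_r(P)$ is the ideal of $S$ whose minimal set of monomial generators is $G(H_r(P))=\{u_{\mathcal I} : \mathcal I\in\mathcal I_r(P)\}$ (equivalently, the Alexander dual of the ideal generated by all $x_{1j_1}\cdots x_{rj_r}$ with $p_{j_1}\le\cdots\le p_{j_r}$). Order the generators decreasingly with respect to the lexicographic order induced by the order of variables $x_{11}>x_{12}>\cdots>x_{1n}>x_{21}>\cdots>x_{2n}>\cdots>x_{r1}>\cdots>x_{rn}$. $H_r(P)$ has linear quotients with respect to this order, and $\operatorname{set}(u)$ denotes the set of variables generating the ideal $(v\in G(H_r(P)) : v>_{\mathrm{lex}}u):u$. Explicitly, $\operatorname{set}(u_{\mathcal I})=\bigcup_{m=1}^{r-1}\{x_{mj} : p_j\in\operatorname{Min}(P\setminus I_m)\}$, where $\operatorname{Min}(P\setminus I_m)$ is the set of minimal elements of $P\setminus I_m$. For $\mathcal I\in\mathcal I_r(P)$ and $x_{mj}\in\operatorname{set}(u_{\mathcal I})$ let $t=\min\{\ell : p_j\in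 I_\ell\}$ (so $t>m$) and let $\mathcal I'$ be the multichain with $I'_\mu=I_\mu$ for $\mu<m$ or $\mu\ge t$, and $I'_\mu=I_\mu\cup\{p_j\}$ for $m\le\mu<t$; then $u_{\mathcal I'}=x_{mj}(u_{\mathcal I}/x_{tj})$. The convention $f(\tau;u)=0$ is used whenever $\tau\not\subset\operatorname{set}(u)$. The symbol $f(\sigma;u)$ is homogeneous of degree $|\sigma|+\deg u$. *)

(* Defs.v *)
From HB Require Import structures.
From mathcomp Require Import all_boot all_order all_algebra.
From mathcomp Require Import boolp.
From mathcomp Require Import mpoly.

Set Implicit Arguments.
Unset Strict Implicit.
Unset Printing Implicit Defensive.

Import Order.TTheory GRing.Theory.
Local Open Scope ring_scope.
Local Open Scope quotient_scope.

Section Span.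
Variables (R : comNzRingType) (M : lmodType R).

Definition lspan (A : M -> Prop) : {pred M} :=
  fun y => `[< exists k (a : 'I_k -> R) (z : 'I_k -> M),
    (forall l, A (z l)) /\ y = \sum_l a l *: z l >].

Lemma lspan_submod_closed (A : M -> Prop) : submod_closed (lspan A).
Proof.
split=> [|c x y /asboolP[k [a [z [Az ->]]]] /asboolP[k' [a' [z' [Az' ->]]]]].
  by apply/asboolP; exists 0%N, (fun=> 0), (fun=> 0); split=> [[]|]; rewrite ?big_ord0.
apply/asboolP; exists (k + k')%N.
exists (fun l => match split l with inl i => c * a i | inr j => a' j end).
exists (fun l => match split l with inl i => z i | inr j => z' j end).
split=> [l|]; first by case: (split l).
rewrite big_split_ord scaler_sumr /=; congr (_ + _); apply: eq_bigr => l _.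
  by rewrite (unsplitK (inl l)) scalerA.
by rewrite (unsplitK (inr l)).
Qed.

Lemma lspan_zmod_closed (A : M -> Prop) : zmod_closed (lspan A).
Proof. exact/GRing.submod_closedB/lspan_submod_closed. Qed.

HB.instance Definition _ (A : M -> Prop) :=
  GRing.isZmodClosed.Build M (lspan A) (lspan_zmod_closed A).

End Span.

(* The quotient module M / lspan A; the library's [Quotient.quot] is only
   a Z-module. *)
Section QuotientModule.
Variables (R : comNzRingType) (M : lmodType R) (A : M -> Prop).

Definition lquot : Type := Quotient.quot (lspan A).
HB.instance Definition _ := GRing.Zmodule.on lquot.
HB.instance Definition _ := EqQuotient.on lquot.
Local Notation Q := lquot.

Definition quot_scale (c : R) : Q -> Q := lift_op1 Q ( *:%R c).

Lemma pi_quot_scale c : {morph \pi_Q : x / c *: x >-> quot_scale c x}.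
Proof.
move=> x; unlock quot_scale; apply/eqP.
rewrite -Quotient.idealrBE -scalerBr -[_ *: _]addr0.
have [h0 h] := lspan_submod_closed A.
by rewrite h // Quotient.idealrBE reprK.
Qed.

Lemma quot_scaleA a b v : quot_scale a (quot_scale b v) = quot_scale (a * b) v.
Proof. by rewrite -[v]reprK -!pi_quot_scale scalerA. Qed.

Lemma quot_scale1 : left_id 1 quot_scale.
Proof. by move=> v; rewrite -[v]reprK -pi_quot_scale scale1r. Qed.

Lemma quot_scaleDr : right_distributive quot_scale +%R.
Proof.
move=> c v w; rewrite -[v]reprK -[w]reprK -raddfD /= -!pi_quot_scale.
by rewrite scalerDr raddfD.
Qed.

Lemma quot_scaleDl v : {morph quot_scale^~ v : a b / a + b}.
Proof. by move=> a b; rewrite -[v]reprK -!pi_quot_scale scalerDl raddfD. Qed.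

HB.instance Definition _ := GRing.Zmodule_isLmodule.Build R Q
  quot_scaleA quot_scale1 quot_scaleDr quot_scaleDl.

Lemma lquot_pi_linear : linear (\pi_Q : M -> Q).
Proof. by move=> c y z; rewrite raddfD /= pi_quot_scale. Qed.

Lemma lquot_pi_eq0 y : \pi_Q y = 0 <-> y \in lspan A.
Proof.
have -> : (0 : Q) = \pi_Q 0 by rewrite raddf0.
have h : (y \in lspan A) = (\pi_Q y == \pi_Q 0).
  by have := Quotient.idealrBE (lspan A) y 0; rewrite subr0.
by rewrite h; split=> /eqP.
Qed.

End QuotientModule.

(* A graded S-module is an S-module M together with its family of homogeneous
   components [gr : nat -> M -> Prop].  Degrees in nat are enough here: the
   module resolved below is generated in degree 0, so its minimal free
   resolution lives in nonnegative degrees. *)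
Section GradedModules.
Variables (K : fieldType) (N : nat).
Local Notation S := {mpoly K[N]}.

Definition is_basis (M : lmodType S) (B : finType) (e : B -> M) : Prop :=
  (forall y, exists a : B -> S, y = \sum_b a b *: e b) /\
  (forall a : B -> S, \sum_b a b *: e b = 0 -> forall b, a b = 0).

Definition homogeneous_basis (M : lmodType S) (gr : nat -> M -> Prop)
    (B : finType) (e : B -> M) (deg : B -> nat) : Prop :=
  is_basis e /\ forall b, gr (deg b) (e b).

(* M is the direct sum of the S(- deg b), as a graded module. *)
Definition graded_free (M : lmodType S) (gr : nat -> M -> Prop) : Prop :=
  exists (B : finType) (e : B -> M) (deg : B -> nat),
    is_basis e /\
    forall k y, gr k y <->
      exists a : B -> S,
        (forall b, if (deg b <= k)%N then a b \is (k - deg b).-homog else a b == 0)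
        /\ y = \sum_b a b *: e b.

Record augmented_complex (M : lmodType S) := AugmentedComplex {
  cx_mod : nat -> lmodType S;
  cx_gr : forall i, nat -> cx_mod i -> Prop;
  cx_d : forall i, {linear cx_mod i.+1 -> cx_mod i};
  cx_aug : {linear cx_mod 0 -> M} }.

Definition graded_minimal_free_resolution (M : lmodType S)
    (gr : nat -> M -> Prop) (F : augmented_complex M) : Prop :=
  [/\ forall i, graded_free (@cx_gr _ F i),
      (forall k y, cx_gr k y -> gr k (cx_aug F y)) /\
      (forall i k y, cx_gr k y -> cx_gr k (cx_d F i y)),
      (forall z, exists y, cx_aug F y = z) /\
      (forall y, cx_aug F y = 0 <-> exists z, y = cx_d F 0 z),
      forall i y, cx_d F i y = 0 <-> exists z, y = cx_d F i.+1 z &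
      (* minimality: the image lies in (x_1, ..., x_N) F_i *)
      forall i y, cx_d F i y \in lspan (fun z => exists l w, z = 'X_l *: w)].

End GradedModules.

Section PosetIdeals.
Variables (disp : Order.disp_t) (P : finPOrderType disp).

Definition poset_ideal (A : {set P}) : bool :=
  [forall x in A, forall y, (y <= x)%O ==> (y \in A)].

(* A multichain is stored with I_0 = set0 in front, as I_0, I_1, ..., I_r. *)
Definition is_multichain (r : nat) (I : {ffun 'I_r.+1 -> {set P}}) : bool :=
  [&& I ord0 == set0, I ord_max == [set: P],
      [forall i, poset_ideal (I i)] &
      [forall i : 'I_r.+1, forall j : 'I_r.+1, (i <= j)%N ==> (I i \subset I j)]].

End PosetIdeals.

(* The pair (i, j) stands for the variable x_{ij}, with 0-based indices. *)
Notation var r n := ('I_r * 'I_n)%type.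

Section HibiType.
Variables (K : fieldType) (r n : nat).
Variables (disp : Order.disp_t) (P : finPOrderType disp) (p : 'I_n -> P).
Local Notation S := {mpoly K[r * n]}.
Local Notation var := (var r n).
Local Notation chain := {ffun 'I_r.+1 -> {set P}}.

(* The 0-based row i : 'I_r is the row i + 1 of the variables x_{ij}, and is
   attached to the poset ideal I_{i+1}. *)
Definition lvl (i : 'I_r) : 'I_r.+1 := lift ord0 i.
Definition lvl_pred (i : 'I_r) : 'I_r.+1 := widen_ord (leqnSn r) i.

Definition vidx (v : var) : 'I_(r * n) := mxvec_index v.1 v.2.
Definition x (v : var) : S := 'X_(vidx v).

(* v > w in the order x_11 > ... > x_1n > x_21 > ... > x_rn. *)
Definition var_gt (v w : var) : bool :=
  (v.1 < w.1)%N || (v.1 == w.1) && (v.2 < w.2)%N.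

Definition lex_gt (a b : 'X_{1..r * n}) : bool :=
  [exists v : var, (b (vidx v) < a (vidx v))%N &&
     [forall w : var, var_gt w v ==> (a (vidx w) == b (vidx w))]].

Definition umon (I : chain) : 'X_{1..r * n} :=
  (\sum_(i < r) \sum_(j < n | p j \in I (lvl i) :\: I (lvl_pred i))
     U_(vidx (i, j)))%MM.

Definition u (I : chain) : S := 'X_[umon I].

Definition is_gen (q : S^o) : Prop := exists2 I, is_multichain I & q = u I.

(* S / H_r(P), the ideal H_r(P) being [lspan is_gen]. *)
Definition SmodHr : lmodType S := lquot is_gen.
Definition SmodHr_pi (q : S^o) : SmodHr := \pi_(lquot is_gen) q.
Definition SmodHr_gr (k : nat) (y : SmodHr) : Prop :=
  exists2 q : S, q \is k.-homog & y = SmodHr_pi q.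

(* The variables in the colon ideal (v in G(H_r(P)) : v >_lex u_I) : u_I.  Any
   set of variables generating this ideal is the set of variables in it. *)
Definition set_u (I : chain) : {set var} :=
  [set v | (x v * u I : S^o) \in
     lspan (fun q : S^o => exists J, [/\ is_multichain J,
              lex_gt (umon J) (umon I) & q = u J])].

Definition level (I : chain) (j : 'I_n) : 'I_r.+1 :=
  [arg min_(l < ord_max | p j \in I l) (l : nat)].

(* The row i with lvl i = level I j.  It exists because I_0 is empty, so the
   default value m is never used on multichains. *)
Definition level_row (I : chain) (m : 'I_r) (j : 'I_n) : 'I_r :=
  odflt m (unlift ord0 (level I j)).

Definition chain_shift (I : chain) (v : var) : chain :=
  [ffun l : 'I_r.+1 => if (lvl v.1 <= l < level I v.2)%N then p v.2 |: I l else I l].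

Definition alpha (s : {set var}) (v : var) : nat := #|[set w in s | var_gt w v]|.

Definition is_symbol (i : nat) (b : {set var} * chain) : bool :=
  [&& is_multichain b.2, b.1 \subset set_u b.2 & #|b.1| == i].

Definition symbol_deg (b : {set var} * chain) : nat := (#|b.1| + mdeg (umon b.2))%N.

End HibiType.

Arguments SmodHr_pi K {r n disp P} p q.
Arguments SmodHr_gr K {r n disp P} p k y.

(* Main.v *)
Require Import Defs.
From HB Require Import structures.
From mathcomp Require Import all_boot all_order all_algebra.
From mathcomp Require Import boolp.
From mathcomp Require Import mpoly.

(** The argument has three parts.

    A graded minimal free resolution is unique up to a graded isomorphism of
    complexes ([minimal_resolution_unique]). Lifting homogeneous basis elements
    along the differentials, one homological degree at a time, gives a map that
    is onto by the graded Nakayama lemma; it splits, and its kernel lies in the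
    irrelevant ideal times itself, hence vanishes ([minimal_cover_unique]). So
    it suffices to show that one particular complex, free on the symbols
    f(s; u_I) with the stated differential, is a graded minimal free
    resolution: every other one then receives its symbols by transport.

    The combinatorics of multichains is governed by the corners of I, the
    variables x_mj with p_j minimal outside I_m. They form set(u_I)
    ([set_uE]): shifting I at a corner gives a lexicographically larger
    generator, and whenever J is not contained in I levelwise, some corner
    variable of I divides u_J but not u_I ([exists_corner]). The differential
    squares to zero because the contributions of removing v then w, and w then
    v, agree up to sign ([bd2C]). For corners in distinct columns the two
    shifts commute. For corners in one column the shift at the upper one
    removes the lower one from the corners and absorbs the shift at the lower
    one. The decomposition map is thus not regular: the corners of the shifted
    multichain need not be corners of I, and a term f(s - v; u_I') can vanish.

    Exactness follows by filtering the complex by the size of the multichains.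
    A shift strictly increases the size, so on the leading part of a chain the
    differential is the Koszul differential of the corners of I ([dif_lead]),
    which is acyclic ([koszul_exact]); in homological degree one the leading
    coefficient lies in a colon ideal, which is generated by the corners.
    Subtracting boundaries removes the leading part of a cycle repeatedly, until
    the size exceeds its maximum ([cycle_exact]). *)

Set Implicit Arguments.
Unset Strict Implicit.
Unset Printing Implicit Defensive.

Import Order.TTheory GRing.Theory.
Local Open Scope ring_scope.

(** * Spans and monomial ideals *)

Section SpanTheory.
Variables (R : comNzRingType) (M : lmodType R).

Lemma lspan_gen (A : M -> Prop) z : A z -> z \in lspan A.
Proof.
move=> Az; apply/asboolP; exists 1%N, (fun=> 1), (fun=> z); split=> //.
by rewrite big_ord1 scale1r.
Qed.

Lemma lspanZD (A : M -> Prop) c y z :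
  y \in lspan A -> z \in lspan A -> c *: y + z \in lspan A.
Proof. by have [_ h] := lspan_submod_closed A; apply: h. Qed.

Lemma lspanZ (A : M -> Prop) c y : y \in lspan A -> c *: y \in lspan A.
Proof. by move=> yA; rewrite -[_ *: _]addr0 lspanZD ?rpred0. Qed.

Lemma lspan_ind (A P : M -> Prop) :
  P 0 -> (forall c y z, P y -> P z -> P (c *: y + z)) ->
  (forall z, A z -> P z) -> forall y, y \in lspan A -> P y.
Proof.
move=> P0 PD PA y /asboolP[k [a [z [Az ->]]]].
apply: (big_ind P) => // [u v Pu Pv|l _]; first by rewrite -[u]scale1r; apply: PD.
by rewrite -[_ *: _]addr0; apply: PD => //; apply: PA.
Qed.

(** The span of a finite family, with one coefficient for each index. *)
Lemma lspan_finP (B : finType) (Q : pred B) (g : B -> M) (A : M -> Prop) y :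
    (forall z, A z <-> exists2 b, Q b & z = g b) ->
  y \in lspan A <-> exists a : B -> R, y = \sum_(b | Q b) a b *: g b.
Proof.
move=> AE; split=> [|[a ->]]; last first.
  by apply: rpred_sum => b Qb; apply/lspanZ/lspan_gen/AE; exists b.
move: y; apply: lspan_ind => [|c _ _ [a1 ->] [a2 ->]|z /AE[b Qb ->]].
- by exists (fun=> 0); rewrite big1 // => b _; rewrite scale0r.
- exists (fun b => c * a1 b + a2 b); rewrite scaler_sumr -big_split /=.
  by apply: eq_bigr => b _; rewrite scalerDl scalerA.
- exists (fun b' => (b' == b)%:R); rewrite (bigD1 b) //= eqxx scale1r.
  by rewrite big1 ?addr0 // => b' /andP[_ /negPf->]; rewrite scale0r.
Qed.

End SpanTheory.

Section MonomialIdeals.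
Variables (K : fieldType) (N : nat).
Local Notation S := {mpoly K[N]}.

Lemma mulmx_msupp (a : S) m m' :
  m' \in msupp (a * 'X_[m]) -> (m <= m')%MM.
Proof.
rewrite (perm_mem (msuppMX _ _)) => /mapP[m1 _ ->]; exact: lem_addr.
Qed.

(** A polynomial lies in a monomial ideal iff each of its monomials is
    divisible by a generator. *)
Lemma lspan_monomials (A : 'X_{1..N} -> Prop) (G : S^o -> Prop) (q : S^o) :
    (forall z, G z <-> exists2 m, A m & z = 'X_[m]) ->
  q \in lspan G <->
  forall m, m \in msupp (q : S) -> exists2 m', A m' & (m' <= m)%MM.
Proof.
move=> GE; split=> [|Hq].
  move: q; apply: lspan_ind => [m|c y z IHy IHz m|z /GE[m Am ->] m'].
  - by rewrite msupp0.
  - move/msuppD_le; rewrite mem_cat => /orP[|/IHz//].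
    move/msuppM_le => /allpairsP[[m1 m2] /= [_ /IHy[m' Am' le] ->]].
    by exists m' => //; apply: lepm_trans le _; apply: lem_addl.
  - by rewrite msuppX inE => /eqP->; exists m => //; apply: lepm_refl.
rewrite [q]mpolyE big_seq; apply: rpred_sum => m /Hq[m' Am' le].
have -> : (q@_m *: 'X_[m] : S) = (q@_m *: 'X_[m - m'] : S) *: ('X_[m'] : S^o).
  by rewrite -[in 'X_[m]](submK le) mpolyXD scalerAl.
by apply: lspanZ; apply: lspan_gen; apply/GE; exists m'.
Qed.

End MonomialIdeals.

(** * Graded modules over a polynomial ring *)

Section GradedTheory.
Variables (K : fieldType) (N : nat).
Local Notation S := {mpoly K[N]}.
Local Notation piH := (pihomog [measure of mdeg]).

(** The products of a variable and a module element; they span the irrelevant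
    ideal times the module. *)
Definition irrelevant (M : lmodType S) : M -> Prop :=
  fun z => exists l w, z = 'X_l *: w.

Lemma irrelevant_sum (M : lmodType S) (y : M) :
  y \in lspan (@irrelevant M) -> exists w : 'I_N -> M, y = \sum_l 'X_l *: w l.
Proof.
move: y; apply: lspan_ind => [|c _ _ [w1 ->] [w2 ->]|_ [l [w ->]]].
- by exists (fun=> 0); rewrite big1 // => l _; rewrite scaler0.
- exists (fun l => c *: w1 l + w2 l); rewrite scaler_sumr -big_split /=.
  by apply: eq_bigr => l _; rewrite scalerDr !scalerA mulrC.
- exists (fun l' => if l' == l then w else 0).
  rewrite (bigD1 l) //= eqxx big1 ?addr0 // => l' /negPf->; exact: scaler0.
Qed.

(** The homogeneous components of a grading: [c k] projects onto degree k. *)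
Record graded_proj (M : lmodType S) (gr : nat -> M -> Prop)
    (c : nat -> M -> M) : Prop := GradedProj {
  gp_add : forall k, {morph c k : y z / y + z};
  gp_gr : forall k y, gr k (c k y);
  gp_id : forall k y, gr k y -> c k y = y;
  gp_neq : forall j k y, gr j y -> j != k -> c k y = 0;
  gp_sum : forall y, exists n, y = \sum_(k < n) c k y }.

Section ProjTheory.
Variables (M : lmodType S) (gr : nat -> M -> Prop) (c : nat -> M -> M).
Hypothesis Hc : graded_proj gr c.

Lemma gp0 k : c k 0 = 0.
Proof. by apply: (addrI (c k 0)); rewrite -(gp_add Hc) !addr0. Qed.

Lemma gpN k y : c k (- y) = - c k y.
Proof. by apply: (addrI (c k y)); rewrite -(gp_add Hc) !subrr gp0. Qed.

Lemma gp_bigsum k (I : finType) (y : I -> M) : c k (\sum_i y i) = \sum_i c k (y i).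
Proof. exact: (big_morph _ (gp_add Hc k) (gp0 k)). Qed.

Lemma gpE k y : gr k y <-> c k y = y.
Proof. by split=> [|<-]; [apply: gp_id Hc _ _ | apply: gp_gr Hc _ _]. Qed.

Lemma gp_gr0 k : gr k 0.
Proof. by apply/gpE/gp0. Qed.

Lemma gp_grB k y z : gr k y -> gr k z -> gr k (y - z).
Proof. by move=> /gpE hy /gpE hz; apply/gpE; rewrite (gp_add Hc) gpN hy hz. Qed.

Lemma gp_gr_sum k (I : finType) (y : I -> M) :
  (forall i, gr k (y i)) -> gr k (\sum_i y i).
Proof.
move=> Hy; apply/gpE; rewrite gp_bigsum.
by apply: eq_bigr => i _; apply/gpE.
Qed.

(** An additive map that shifts degrees by d commutes with the projections. *)
Lemma gp_comm (M' : lmodType S) (gr' : nat -> M' -> Prop) c' d (phi : M -> M') :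
    graded_proj gr' c' -> {morph phi : y z / y + z} ->
    (forall k y, gr k y -> gr' (d + k)%N (phi y)) ->
  forall k y, c' (d + k)%N (phi y) = phi (c k y).
Proof.
move=> Hc' phiD phiG k y.
have phi0 : phi 0 = 0 by apply: (addrI (phi 0)); rewrite -phiD !addr0.
have c'D := gp_add Hc' (d + k)%N.
have c'0 : c' (d + k)%N 0 = 0 by apply: (addrI (c' (d + k)%N 0)); rewrite -c'D !addr0.
have [n yE] := gp_sum Hc y.
rewrite [in LHS]yE (big_morph phi phiD phi0) (big_morph _ c'D c'0).
rewrite [in RHS]yE gp_bigsum (big_morph phi phiD phi0).
apply: eq_bigr => j _; have [<-|jk] := eqVneq (j : nat) k.
  rewrite (gp_id Hc (gp_gr Hc j y)).
  exact/(gp_id Hc')/phiG/(gp_gr Hc).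
rewrite (gp_neq Hc (gp_gr Hc j y)) // phi0.
by rewrite (gp_neq Hc' (phiG _ _ (gp_gr Hc j y))) // eqn_add2l.
Qed.

End ProjTheory.

Section Basis.
Variables (M : lmodType S) (B : finType) (e : B -> M).
Hypothesis He : is_basis e.

Lemma basis_inj (a a' : B -> S) :
  \sum_b a b *: e b = \sum_b a' b *: e b -> a =1 a'.
Proof.
move=> E b; apply/eqP; rewrite -subr_eq0; apply/eqP.
apply: (He.2 (fun b => a b - a' b)) => {b}.
transitivity (\sum_b a b *: e b - \sum_b a' b *: e b); last by rewrite E subrr.
by rewrite -sumrB; apply: eq_bigr => b _; rewrite scalerBl.
Qed.

(** Coordinates with respect to a basis. *)
Lemma basis_coord : exists co : M -> B -> S,
  (forall y, y = \sum_b co y b *: e b) /\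
  (forall a b, co (\sum_b a b *: e b) b = a b).
Proof.
have [co coE] := choice He.1; exists co; split=> // a b.
by apply: (@basis_inj (co _) a); rewrite -coE.
Qed.

(** A module map may be prescribed freely on a basis. *)
Lemma basis_extend (M' : lmodType S) (g : B -> M') :
  exists phi : {linear M -> M'},
    forall a : B -> S, phi (\sum_b a b *: e b) = \sum_b a b *: g b.
Proof.
have [co [coE coK]] := basis_coord.
have phiE a : \sum_b co (\sum_b a b *: e b) b *: g b = \sum_b a b *: g b.
  by apply: eq_bigr => b _; rewrite coK.
pose phi y := \sum_b co y b *: g b.
have phi_lin : linear phi.
  move=> c y z; rewrite {1}/phi [in LHS](coE y) [in LHS](coE z).
  rewrite scaler_sumr -big_split /=.
  rewrite (eq_bigr (fun b => (c * co y b + co z b) *: e b)) => [|b _]; last first.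
    by rewrite scalerDl scalerA.
  rewrite phiE scaler_sumr -big_split /=.
  by apply: eq_bigr => b _; rewrite scalerDl scalerA.
pose phiL := GRing.isLinear.Build S M M' *:%R phi phi_lin.
by exists (HB.pack_for {linear M -> M'} phi phiL).
Qed.

Lemma basis_iso (M' : lmodType S) (phi : {linear M -> M'}) :
  bijective phi -> is_basis (phi \o e).
Proof.
case=> psi phiK psiK; split=> [y|a aE].
  have [a yE] := He.1 (psi y); exists a.
  rewrite -(psiK y) yE linear_sum; apply: eq_bigr => b _; exact: linearZ.
apply: He.2; apply: (can_inj phiK); rewrite linear0 linear_sum -[RHS]aE.
by apply: eq_bigr => b _; apply: linearZ.
Qed.

(** A submodule of a free module contained in the irrelevant ideal times
    itself is zero: the coefficients of its elements have order at least k
    for all k. *)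
Lemma irrelevant_self_eq0 (Z : M -> Prop) :
    (forall z, Z z -> exists w : 'I_N -> M,
       z = \sum_l 'X_l *: w l /\ forall l, Z (w l)) ->
  forall z, Z z -> z = 0.
Proof.
move=> ZI z Zz; have [co [coE coK]] := basis_coord.
have ord k : forall z, Z z -> forall b m, m \in msupp (co z b) -> (k <= mdeg m)%N.
  elim: k => // k IH {Zz}z /ZI[w [zE Zw]] b m.
  have -> : co z b = \sum_l 'X_l * co (w l) b.
    rewrite -(coK (fun b => \sum_l 'X_l * co (w l) b) b); congr (co _ b).
    rewrite zE; under eq_bigr => l _ do rewrite {1}(coE (w l)) scaler_sumr.
    rewrite exchange_big; apply: eq_bigr => b' _.
    by rewrite scaler_suml; apply: eq_bigr => l _; rewrite scalerA.
  move/msupp_sum_le/flatten_mapP => [l _] /msuppM_le /allpairsP[[m1 m2] /= []].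
  rewrite msuppX inE => /eqP-> /(IH _ (Zw l)) h ->.
  by rewrite mdegD mdeg1 add1n.
rewrite (coE z) big1 // => b _.
have [->|nz] := eqVneq (co z b) 0; first exact: scale0r.
by have := ord (msize (co z b)) z Zz b _ (mlead_supp nz); rewrite -(mlead_deg nz) ltnn.
Qed.

End Basis.

Section GradedFree.
Variables (M : lmodType S) (gr : nat -> M -> Prop).
Hypothesis Hgr : graded_free gr.

Lemma graded_free_proj : exists c, graded_proj gr c.
Proof.
have [B [e [deg [He grE]]]] := Hgr.
have [co [coE coK]] := basis_coord He.
pose pr k (a : S) b := if (deg b <= k)%N then piH (k - deg b) a else 0.
have prD k b : {morph pr k ^~ b : x y / x + y}.
  by move=> x y; rewrite /pr; case: ifP; rewrite ?addr0 // pihomogD.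
have hom k a b : if (deg b <= k)%N then pr k a b \is (k - deg b).-homog else pr k a b == 0.
  by rewrite /pr; case: ifP => [-> | ->] //=; apply: pihomogP.
exists (fun k y => \sum_b pr k (co y b) b *: e b); split.
- move=> k y z; rewrite -big_split /=; apply: eq_bigr => b _.
  rewrite -scalerDl -prD; congr (pr _ _ _ *: _).
  rewrite -(coK (fun b => co y b + co z b) b); congr (co _ b).
  rewrite {1}(coE y) {1}(coE z) -big_split /=.
  by apply: eq_bigr => b' _; rewrite scalerDl.
- move=> k y; apply/grE; exists (fun b => pr k (co y b) b); split=> // b; exact: hom.
- move=> k y /grE[a [Ha ->]]; apply: eq_bigr => b _; rewrite coK; congr (_ *: _).
  by have := Ha b; rewrite /pr; case: ifP => _; [apply: pihomog_dE | move/eqP->].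
- move=> j k y /grE[a [Ha ->]] jk; rewrite big1 // => b _; rewrite coK /pr.
  have := Ha b; case: (leqP (deg b) k) => bk; last by rewrite scale0r.
  case: leqP => bj; last by move/eqP->; rewrite pihomog0 scale0r.
  move=> h; rewrite (pihomog_ne0 _ h) ?scale0r //.
  by apply: contra jk => /eqP E; rewrite -(subnK bj) E subnK.
- move=> y; pose n := (\max_b (deg b + msize (co y b)))%N; exists n.
  rewrite exchange_big /= {1}(coE y); apply: eq_bigr => b _.
  rewrite -scaler_suml; congr (_ *: _).
  have le : (deg b + msize (co y b) <= n)%N by apply: (leq_bigmax b).
  have le' : (deg b <= n)%N by apply: leq_trans le; apply: leq_addr.
  rewrite -(subnKC le') big_split_ord /= big1 ?add0r => [|i _]; last first.
    by rewrite /pr leqNgt ltn_ord.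
  rewrite [LHS](pihomog_partitionE (mf := [measure of mdeg]) (k := n - deg b)).
    by apply: eq_bigr => i _; rewrite /pr leq_addr addKn.
  by rewrite leq_subRL.
Qed.

Lemma graded_freeZ j k (a : S) y : a \is j.-homog -> gr k y -> gr (j + k)%N (a *: y).
Proof.
have [B [e [deg [He grE]]]] := Hgr => Ha /grE[b [Hb ->]]; apply/grE.
exists (fun i => a * b i); split=> [i|]; last first.
  by rewrite scaler_sumr; apply: eq_bigr => i _; rewrite scalerA.
have := Hb i; case: leqP => ik h; last first.
  rewrite (eqP h) mulr0; case: ifP => _ //; exact: dhomog0.
by rewrite (leq_trans ik (leq_addl _ _)) -addnBA // dhomogM.
Qed.

(** A combination of homogeneous elements with homogeneous coefficients of
    complementary degrees is homogeneous. *)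
Lemma graded_free_sum k (B : finType) (g : B -> M) (deg : B -> nat) (a : B -> S) :
    (forall b, gr (deg b) (g b)) ->
    (forall b, if (deg b <= k)%N then a b \is (k - deg b).-homog else a b == 0) ->
  gr k (\sum_b a b *: g b).
Proof.
have [c Hc] := graded_free_proj => Hg Ha; apply: (gp_gr_sum Hc) => b.
have := Ha b; case: leqP => bk h; last by rewrite (eqP h) scale0r; apply: gp_gr0 Hc _.
by rewrite -(subnK bk); apply: graded_freeZ h (Hg b).
Qed.

(** Nakayama's lemma for a graded submodule [Z] of a graded free module. *)
Lemma graded_nakayama c (Z : M -> Prop) :
    graded_proj gr c ->
    (forall y z, Z y -> Z z -> Z (y + z)) -> (forall a y, Z y -> Z (a *: y)) ->
    Z 0 ->
    (forall k y, Z y -> Z (c k y)) ->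
    (forall y, exists z w, [/\ Z z, w \in lspan (@irrelevant M) & y = z + w]) ->
  forall y, Z y.
Proof.
move=> Hc ZD ZZ Z0 Zc ZI.
have ZH k : forall y, gr k y -> Z y.
  elim/ltn_ind: k => k IH y yk; have [z [w [Zz /irrelevant_sum[v wE] yE]]] := ZI y.
  rewrite -(gp_id Hc yk) yE (gp_add Hc) wE (gp_bigsum Hc).
  apply: (ZD) (Zc _ _ Zz) _; apply: (big_ind Z) => // l _.
  have shift k' y' : gr k' y' -> gr (1 + k')%N ('X_l *: y').
    by apply: graded_freeZ; rewrite dhomogX; apply/eqP/mdeg1.
  have Xadd : {morph GRing.scale ('X_l : S) : y z / y + z :> M}.
    by move=> y1 y2; rewrite scalerDr.
  case: k IH yk => [|k] IH yk.
    have [n ->] := gp_sum Hc (v l).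
    rewrite scaler_sumr (gp_bigsum Hc) big1 // => j _.
    exact: (gp_neq Hc (shift _ _ (gp_gr Hc j _))).
  rewrite -(add1n k) (gp_comm Hc Hc Xadd shift).
  by apply: ZZ; apply: (IH k) => //; apply: gp_gr Hc _ _.
move=> y; have [n ->] := gp_sum Hc y.
by apply: (big_ind Z) => // k _; apply: ZH (gp_gr Hc k y).
Qed.

End GradedFree.

(** * Uniqueness of graded minimal free resolutions *)

(** Compares two graded free modules with the same image, [F] under [DF] and
    [G] under [psi \o DG], where [psi] is injective on the image of [DG]. The
    homogeneous lift [phi] of [psi \o DG] along [DF] is onto by the graded
    Nakayama lemma. It splits because [F] is free, so its kernel [Z], which
    lies in the irrelevant ideal times [G], satisfies the hypothesis of
    [irrelevant_self_eq0]. *)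
Lemma minimal_cover_unique (F G X Y : lmodType S)
    (grF : nat -> F -> Prop) (grG : nat -> G -> Prop)
    (DF : {linear F -> X}) (DG : {linear G -> Y}) (psi : {linear Y -> X}) :
    graded_free grF -> graded_free grG ->
    (forall k z, grG k z -> exists2 y, grF k y & DF y = psi (DG z)) ->
    (forall y, exists z, DF y = psi (DG z)) ->
    (forall z, psi (DG z) = 0 -> DG z = 0) ->
    (forall y, DF y = 0 -> y \in lspan (@irrelevant F)) ->
    (forall z, DG z = 0 -> z \in lspan (@irrelevant G)) ->
  exists phi : {linear G -> F}, [/\ bijective phi,
    forall k z, grG k z -> grF k (phi z) &
    forall z, DF (phi z) = psi (DG z)].
Proof.
move=> HF HG lift onto inj kerF kerG.
have [cF HcF] := graded_free_proj HF; have [cG HcG] := graded_free_proj HG.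
have [B [e [deg [He grE]]]] := HG.
have e_gr b : grG (deg b) (e b).
  apply/grE; exists (fun b' => (b' == b)%:R); split=> [b'|].
    have [->|_] := eqVneq b' b; last by case: ifP => _ //; apply: dhomog0.
    by rewrite leqnn subnn; apply: dhomog1.
  rewrite (bigD1 b) //= eqxx scale1r big1 ?addr0 // => b' /negPf->.
  by rewrite scale0r.
have /choice[g gP] b : exists y, grF (deg b) y /\ DF y = psi (DG (e b)).
  by have [y] := lift _ _ (e_gr b); exists y.
have [phi phiE] := basis_extend He g.
have phi_gr k z : grG k z -> grF k (phi z).
  move=> /grE[a [Ha ->]]; rewrite phiE.
  by apply: (graded_free_sum HF _ Ha) => b; have [] := gP b.
have phiD z : DF (phi z) = psi (DG z).
  have [a ->] := He.1 z; rewrite phiE !linear_sum; apply: eq_bigr => b _.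
  by rewrite !linearZ; have [_ /= ->] := gP b.
(* Nakayama: F is the image of phi plus the kernel of DF. *)
have phi_onto y : exists z, phi z = y.
  apply: (graded_nakayama HF HcF (Z := fun y => exists z, phi z = y)) => {y}.
  - by move=> _ _ [y <-] [z <-]; exists (y + z); rewrite linearD.
  - by move=> a _ [y <-]; exists (a *: y); rewrite linearZ.
  - by exists 0; rewrite linear0.
  - move=> k _ [z <-]; exists (cG k z).
    by rewrite -(gp_comm (d := 0) HcG HcF (linearD phi)).
  - move=> y; have [z yz] := onto y.
    exists (phi z), (y - phi z); split; [by exists z | | by rewrite addrC subrK].
    by apply: kerF; rewrite linearB yz phiD subrr.
have [C [e' [_ [He' _]]]] := HF.
have [h hP] := choice (fun c => phi_onto (e' c)).
have [sec secE] := basis_extend He' h.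
have secK : cancel sec phi.
  move=> y; have [a ->] := He'.1 y; rewrite secE linear_sum.
  by apply: eq_bigr => c _; rewrite linearZ hP.
(* The projection z - sec (phi z) onto the kernel of phi moves an expression
   of z as a combination of variables inside that kernel. *)
have phi_inj z : phi z = 0 -> z = 0.
  apply: (irrelevant_self_eq0 He (Z := fun z => phi z = 0)) => {}z phiz.
  have /kerG/irrelevant_sum[w zE] : DG z = 0 by apply: inj; rewrite -phiD phiz linear0.
  exists (fun l => w l - sec (phi (w l))); split=> [|l]; last first.
    by rewrite linearB secK subrr.
  rewrite -[LHS]subr0 -[X in _ - X](linear0 sec) -phiz zE
    (linear_sum phi) (linear_sum sec) -sumrB.
  by apply: eq_bigr => l _; rewrite scalerBr (linearZ_LR phi) (linearZ_LR sec).
exists phi; split=> //; apply: (Bijective (g := sec)) => // z.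
by apply/eqP; rewrite -subr_eq0; apply/eqP/phi_inj; rewrite linearB secK subrr.
Qed.

(** Chain maps that agree with the identity of [M] and are built degree by
    degree. The property kept along the way is that the map in degree i
    identifies the images of the next differentials. *)
Theorem minimal_resolution_unique (M : lmodType S) (gr : nat -> M -> Prop)
    (F G : augmented_complex M) :
    (exists c, graded_proj gr c) ->
    graded_minimal_free_resolution gr F ->
    graded_minimal_free_resolution gr G ->
  exists phi : forall i, {linear cx_mod G i -> cx_mod F i},
    [/\ forall i, bijective (phi i),
        forall i k z, cx_gr k z -> cx_gr k (phi i z),
        forall z, cx_aug F (phi 0%N z) = cx_aug G z &
        forall i z, cx_d F i (phi i.+1 z) = phi i (cx_d G i z)].
Proof.
move=> [cM HcM] [Ffree [FaugH FdH] [Faug Faugker] Fker Fmin].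
move=> [Gfree [GaugH GdH] [Gaug Gaugker] Gker Gmin].
pose good i (phi : {linear cx_mod G i -> cx_mod F i}) :=
  [/\ bijective phi, forall k z, cx_gr k z -> cx_gr k (phi z) &
   forall z, (exists y, z = cx_d G i y) <-> (exists y, phi z = cx_d F i y)].
have base : exists phi : {linear cx_mod G 0 -> cx_mod F 0},
    good 0%N phi /\ forall z, cx_aug F (phi z) = cx_aug G z.
  have [cF HcF] := graded_free_proj (Ffree 0%N).
  have [|||||phi [phi_bij phiH phiE]] := minimal_cover_unique
    (DF := cx_aug F) (DG := cx_aug G) (psi := idfun) (Ffree 0%N) (Gfree 0%N).
  - move=> k z zk /=; have [y yE] := Faug (cx_aug G z); exists (cF k y).
      exact: gp_gr HcF _ _.
    rewrite -(gp_comm (d := 0) HcF HcM (linearD (cx_aug F)) FaugH) yE.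
    exact/(gp_id HcM)/GaugH.
  - by move=> y; have [z zE] := Gaug (cx_aug F y); exists z.
  - by [].
  - by move=> y /Faugker[z ->]; apply: Fmin.
  - by move=> y /Gaugker[z ->]; apply: Gmin.
  exists phi; split=> //; split=> // z.
  by rewrite -Gaugker -Faugker phiE.
have step i phi : good i phi -> exists phi' : {linear cx_mod G i.+1 -> cx_mod F i.+1},
    good i.+1 phi' /\ forall z, cx_d F i (phi' z) = phi (cx_d G i z).
  move=> [[psi phiK psiK] phiH phiI].
  have phi0 z : phi z = 0 -> z = 0.
    by move=> h; rewrite -(phiK z) h -(linear0 phi) phiK.
  have [cF HcF] := graded_free_proj (Ffree i.+1).
  have [cF' HcF'] := graded_free_proj (Ffree i).
  have [|||||phi' [phi'_bij phi'H phi'E]] := minimal_cover_unique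
    (DF := cx_d F i) (DG := cx_d G i) (psi := phi) (Ffree i.+1) (Gfree i.+1).
  - move=> k z zk.
    have [y yE] : exists y, phi (cx_d G i z) = cx_d F i y by apply/phiI; exists z.
    exists (cF k y); first exact: gp_gr HcF _ _.
    rewrite -(gp_comm (d := 0) HcF HcF' (linearD (cx_d F i)) (FdH i)) -yE.
    exact/(gp_id HcF')/phiH/GdH.
  - move=> y; have [|z zE] := (phiI (psi (cx_d F i y))).2.
      by exists y; rewrite psiK.
    by exists z; rewrite -zE psiK.
  - by move=> z; apply: phi0.
  - by move=> y /Fker[z ->]; apply: Fmin.
  - by move=> y /Gker[z ->]; apply: Gmin.
  exists phi'; split=> //; split=> // z.
  rewrite -Gker -Fker phi'E; split=> [->|/phi0//]; exact: linear0.
(* Dependent choice along [step]. *)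
pose T i := {phi | good i phi}.
pose t0 : T 0%N := let h := cid base in exist _ (sval h) (svalP h).1.
pose tS i (t : T i) : T i.+1 :=
  let h := cid (step i (sval t) (svalP t)) in exist _ (sval h) (svalP h).1.
pose t := fix t i : T i := if i is j.+1 then tS j (t j) else t0.
exists (fun i => sval (t i)); split.
- by move=> i; have [] := svalP (t i).
- by move=> i; have [] := svalP (t i).
- exact: (svalP (cid base)).2.
- by move=> i; apply: (svalP (cid (step i (sval (t i)) (svalP (t i))))).2.
Qed.

End GradedTheory.

(** * Exactness of the Koszul complex of a set of variables *)

Section Koszul.
Variables (K : fieldType) (N : nat) (T : finType).
Variables (enc : T -> nat) (X : T -> 'I_N).
Hypotheses (enc_inj : injective enc) (X_inj : injective X).
Local Notation S := {mpoly K[N]}.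

(** The exponent of the sign attached to the removal of [v] from [s]. *)
Definition ksign (s : {set T}) (v : T) : nat := #|[set w in s | (enc w < enc v)%N]|.

(** The Koszul differential in coordinates: [c s] is the coefficient of the
    exterior monomial indexed by [s], and [enc] orders the variables. *)
Definition kd (c : {set T} -> S) (s : {set T}) : S :=
  \sum_(v | v \notin s) (-1) ^+ ksign s v * 'X_(X v) * c (v |: s).

(** Koszul chains of degree i on the variables in [V]. *)
Definition kchain (V : {set T}) (i : nat) (c : {set T} -> S) : Prop :=
  forall s, c s != 0 -> s \subset V /\ #|s| = i.

(** Membership in the ideal generated by the variables in [V]. *)
Definition var_ideal (V : {set T}) (a : S) : Prop :=
  exists b : T -> S, a = \sum_(v in V) b v * 'X_(X v).

Lemma var_idealP V a :
  var_ideal V a <-> forall m, m \in msupp a -> exists2 v, v \in V & m (X v) != 0%N.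
Proof.
pose G (z : S^o) := exists2 v, v \in V & z = 'X_(X v) :> S.
have h1 : (a : S^o) \in lspan G <-> var_ideal V a.
  exact: (lspan_finP (M := S^o) (a : S^o) (fun z => iff_refl (G z))).
have h2 : (a : S^o) \in lspan G <-> forall m, m \in msupp a ->
    exists2 m', (exists2 v, v \in V & m' = U_(X v)%MM) & (m' <= m)%MM.
  apply: lspan_monomials => z; split=> [[v Vv ->]|[_ [v Vv ->] ->]]; last by exists v.
  by exists U_(X v)%MM => //; exists v.
split=> [/h1/h2 h m /h[_ [v Vv ->]]|h].
  by rewrite lep1mP => ?; exists v.
apply/h1/h2 => m /h[v Vv mv]; exists U_(X v)%MM; first by exists v.
by rewrite lep1mP.
Qed.

(** A variable outside [W] is a nonzero divisor modulo the ideal of [W]. *)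
Lemma var_ideal_colon (W : {set T}) v a :
  v \notin W -> var_ideal W (a * 'X_(X v)) -> var_ideal W a.
Proof.
move=> vW /var_idealP h; apply/var_idealP => m ma.
have [|w Ww] := h (m + U_(X v))%MM.
  by rewrite (perm_mem (msuppMX _ _)) addmC; apply: map_f.
rewrite mnmDE mnm1E; have [/X_inj vw|_] := eqVneq (X v) (X w).
  by rewrite vw Ww in vW.
by rewrite addn0 => ?; exists w.
Qed.

Lemma kchain_eq0 V i c (s : {set T}) : kchain V i c -> ~~ (s \subset V) || (#|s| != i) -> c s = 0.
Proof.
move=> Hc; have [->//|/Hc[-> ->]] := eqVneq (c s) 0.
by rewrite eqxx.
Qed.

Lemma koszul_exact0 V c : kchain V 0 c -> var_ideal V (c set0) ->
  exists y, kchain V 1 y /\ forall s, kd y s = c s.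
Proof.
move=> Hc [b cE]; pose y (s : {set T}) := \sum_(v in V | s == [set v]) b v.
have Hy : kchain V 1 y.
  move=> s; case: (pickP (fun v => (v \in V) && (s == [set v]))) => [v /andP[Vv /eqP->] _|h].
    by rewrite sub1set cards1.
  by rewrite /y big_pred0 ?eqxx.
exists y; split=> // s; have [->|s0] := eqVneq s set0; last first.
  rewrite (kchain_eq0 Hc) ?cards_eq0 ?s0 ?orbT //.
  rewrite /kd big1 // => w ws; rewrite (kchain_eq0 Hy) ?mulr0 //.
  by rewrite cardsU1 ws add1n eqSS cards_eq0 s0 orbT.
rewrite cE /kd (eq_bigl predT) => [|v]; last by rewrite inE.
rewrite [RHS]big_mkcond; apply: eq_bigr => v _.
have -> : ksign set0 v = 0%N by apply: eq_card0 => w; rewrite !inE.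
rewrite expr0 mul1r setU0 /y; case: ifP => [Vv|Vv]; last first.
  by rewrite big_pred0 ?mulr0 // => w; rewrite (inj_eq set1_inj) andbC; case: eqP => // <-.
rewrite (big_pred1 v) => [|w]; first by rewrite mulrC.
by rewrite (inj_eq set1_inj) andbC eq_sym /=; case: eqP => // ->; rewrite Vv.
Qed.

Section Split.
Variables (v : T) (W : {set T}).
Hypothesis v_min : forall w, w \in W -> (enc v < enc w)%N.

(** Splitting a chain on v |: W as c0 + v /\ c1, with v the first variable. *)
Lemma kd_split i c (s : {set T}) : kchain (v |: W) i c -> v \notin s ->
  kd c s = kd (fun s => if v \in s then 0 else c s) s + 'X_(X v) * c (v |: s) /\
  kd c (v |: s) = - kd (fun s => if v \in s then 0 else c (v |: s)) s.
Proof.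
move=> Hc vs; split.
  rewrite /kd (bigD1 v) //= addrC; congr (_ + _).
    rewrite [RHS](bigD1 v) //= setU11 mulr0 add0r.
    apply: eq_bigr => w /andP[_ wv]; rewrite !inE (negPf vs) orbF.
    by rewrite eq_sym (negPf wv).
  have [->|/Hc[sV _]] := eqVneq (c (v |: s)) 0; first by rewrite !mulr0.
  have -> : ksign s v = 0%N; last by rewrite expr0 mul1r.
  apply: eq_card0 => w; rewrite !inE; apply/negP => /andP[ws].
  have /(subsetP sV) : w \in v |: s by rewrite !inE ws orbT.
  by rewrite !inE => /orP[/eqP->|/v_min]; rewrite ?ltnn // ltnNge => /negP h /ltnW.
rewrite /kd [X in _ = - X](bigD1 v) //= setU11 mulr0 add0r -sumrN.
apply: eq_big => [w|w]; rewrite !inE negb_or; first exact: andbC.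
move=> /andP[wv ws]; rewrite eq_sym (negPf wv) (negPf vs) /=.
rewrite setUCA; have [->|/Hc[sV _]] := eqVneq (c (v |: (w |: s))) 0.
  by rewrite !mulr0 oppr0.
rewrite -!mulNr; congr (_ * _ * _).
suff -> : ksign (v |: s) w = (ksign s w).+1 by rewrite exprS mulN1r.
have vw : (enc v < enc w)%N.
  have /(subsetP sV) : w \in v |: (w |: s) by rewrite !inE eqxx orbT.
  by rewrite !inE (negPf wv) => /v_min.
rewrite /ksign (_ : [set _ in v |: s | _] = v |: [set w0 in s | (enc w0 < enc w)%N]).
  by rewrite cardsU1 !inE (negPf vs).
by apply/setP => u; rewrite !inE; case: eqP => //= ->; rewrite vw.
Qed.

End Split.

Lemma kdD c c' s : kd (fun s => c s + c' s) s = kd c s + kd c' s.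
Proof. by rewrite -big_split; apply: eq_bigr => v _; rewrite mulrDr. Qed.

Lemma kdZ a c s : kd (fun s => a * c s) s = a * kd c s.
Proof. by rewrite mulr_sumr; apply: eq_bigr => v _; rewrite mulrCA. Qed.

Lemma kd_eq0 (V : {set T}) i c (s : {set T}) v : kchain V i c -> v \in s -> v \notin V -> kd c s = 0.
Proof.
move=> Hc vs vV; rewrite /kd big1 // => w _.
rewrite (kchain_eq0 Hc) ?mulr0 //; apply/orP; left; apply: contra vV => /subsetP; apply.
by rewrite !inE vs orbT.
Qed.

(** The Koszul complex on a set of variables is acyclic in positive degree.
    Induction on the set, removing its first variable v: if c = c0 + v /\ c1
    is a cycle then c1 bounds some y1 (in degree 0 because v is a nonzero
    divisor modulo the other variables), and c0 + v * y1 is a cycle not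
    involving v. *)
Theorem koszul_exact V i c :
    kchain V i.+1 c -> (forall s, kd c s = 0) ->
  exists y, kchain V i.+2 y /\ forall s, kd y s = c s.
Proof.
have [k] := ubnP #|V|; elim: k => // k IH in V i c *; rewrite ltnS => Vk Hc dc.
have [V0|[v0 Vv0]] := set_0Vmem V.
  exists (fun=> 0); split=> [s|s]; first by rewrite eqxx.
  rewrite /kd big1 => [|v _]; last by rewrite mulr0.
  rewrite (kchain_eq0 Hc) // V0 subset0; have [->|//] := eqVneq s set0.
  by rewrite cards0.
(* Removing the first variable makes its own sign trivial. *)
case: (arg_minnP enc Vv0) => v Vv v_min; pose W := V :\ v.
have VE : V = v |: W by rewrite setD1K.
have vW : v \notin W by rewrite !inE eqxx.
have {}v_min w : w \in W -> (enc v < enc w)%N.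
  rewrite !inE => /andP[wv /v_min]; rewrite leq_eqVlt => /orP[/eqP/enc_inj E|//].
  by rewrite E eqxx in wv.
have Wk : (#|W| < k)%N by apply: leq_trans Vk; rewrite VE cardsU1 vW.
rewrite VE in Hc *; clearbody W; clear VE Vk Vv Vv0 V.
pose c0 (s : {set T}) := if v \in s then 0 else c s.
pose c1 (s : {set T}) := if v \in s then 0 else c (v |: s).
have Hc0 : kchain W i.+1 c0.
  move=> s; rewrite /c0; case: ifP => [|vs /Hc[sV ->]]; rewrite ?eqxx //; split=> //.
  apply/subsetP => u us; have := subsetP sV u us; rewrite !inE.
  by case: eqP => // E; rewrite -E us in vs.
have Hc1 : kchain W i c1.
  move=> s; rewrite /c1; case: ifP => [|vs /Hc[sV]]; rewrite ?eqxx //.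
  rewrite cardsU1 vs => -[si]; split=> //; apply/subsetP => u us.
  have /(subsetP sV) : u \in v |: s by rewrite !inE us orbT.
  by rewrite !inE; case: eqP => // E; rewrite -E us in vs.
have split0 (s : {set T}) : v \notin s -> kd c0 s + 'X_(X v) * c1 s = 0.
  move=> vs; have [E _] := kd_split v_min Hc vs.
  by rewrite dc in E; rewrite /c1 (negPf vs) -E.
have split1 (s : {set T}) : v \notin s -> kd c1 s = 0.
  move=> vs; have [_] := kd_split v_min Hc vs.
  by rewrite dc => /eqP; rewrite eq_sym oppr_eq0 => /eqP.
have [y1 [Hy1 dy1]] : exists y1, kchain W i.+1 y1 /\ forall s, kd y1 s = c1 s.
  case: i Hc Hc0 Hc1 => [|i] Hc Hc0 Hc1; last first.
    apply: IH => // s; have [vs|vs] := boolP (v \in s); last exact: split1.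
    exact: kd_eq0 Hc1 vs vW.
  apply: koszul_exact0 => //; apply: (var_ideal_colon vW); rewrite mulrC.
  have -> : 'X_(X v) * c1 set0 = - kd c0 set0.
    by apply/eqP; rewrite -addr_eq0 addrC split0 ?inE.
  exists (fun w => - ((-1) ^+ ksign set0 w * c0 [set w])).
  rewrite /kd -sumrN big_mkcond [RHS]big_mkcond; apply: eq_bigr => w _.
  rewrite inE /= setU0; case: ifP => wW; first by rewrite mulrAC mulNr.
  by rewrite (kchain_eq0 Hc0) ?mulr0 ?oppr0 // sub1set wW.
have [||y0 [Hy0 dy0]] := IH W i (fun s => c0 s + 'X_(X v) * y1 s) Wk.
- move=> s; have [->|/Hc0//] := eqVneq (c0 s) 0; rewrite add0r.
  by have [->|/Hy1//] := eqVneq (y1 s) 0; rewrite mulr0 eqxx.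
- move=> s; rewrite kdD kdZ dy1; have [vs|vs] := boolP (v \in s); last exact: split0.
  by rewrite (kd_eq0 Hc0 vs vW) /c1 vs mulr0 addr0.
pose y (s : {set T}) := if v \in s then - y1 (s :\ v) else y0 s.
have Hy : kchain (v |: W) i.+2 y.
  move=> s; rewrite /y; case: ifP => vs.
    rewrite oppr_eq0 => /Hy1[sW si]; rewrite (cardsD1 v) vs si; split=> //.
    by rewrite -(setD1K vs) setUS.
  by move/Hy0 => [sW ->]; split=> //; apply: subset_trans sW (subsetUr _ _).
have kd_ext f g s : f =1 g -> kd f s = kd g s.
  by move=> fg; apply: eq_bigr => w _; rewrite fg.
have y_out (s : {set T}) : v \notin s -> y (v |: s) = - y1 s.
  by move=> vs; rewrite /y setU11 setU1K.
exists y; split=> // s; have [vs|vs] := boolP (v \in s).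
  have vs' : v \notin s :\ v by rewrite !inE eqxx.
  rewrite -(setD1K vs); have [_ ->] := kd_split v_min Hy vs'.
  transitivity (- kd (fun s => (-1) * y1 s) (s :\ v)).
    congr (- _); apply: kd_ext => s'; case: ifP => vs1; last by rewrite y_out ?vs1 ?mulN1r.
    rewrite (kchain_eq0 Hy1) ?mulr0 //; apply/orP; left; apply: contra vW => /subsetP; exact.
  by rewrite kdZ mulN1r opprK dy1 /c1 (negPf vs').
have [-> _] := kd_split v_min Hy vs; rewrite y_out //.
rewrite (kd_ext _ y0) => [|s']; last first.
  case: ifP => vs1; last by rewrite /y vs1.
  rewrite (kchain_eq0 Hy0) //.
  by apply/orP; left; apply: contra vW => /subsetP; exact.
by rewrite dy0 /c0 (negPf vs) mulrN addrK.
Qed.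

End Koszul.

(** * Multichains of poset ideals *)

Section Multichains.
Variables (K : fieldType) (r n : nat).
Variables (disp : Order.disp_t) (P : finPOrderType disp) (p : 'I_n -> P).
Hypotheses (p_bij : bijective p).
Hypothesis p_label : forall i j : 'I_n, (p i < p j)%O -> (i < j)%N.
Local Notation S := {mpoly K[r * n]}.
Local Notation var := (var r n).
Local Notation chain := {ffun 'I_r.+1 -> {set P}}.
Implicit Types (I J : chain) (v w : var).

Let p_inj : injective p := bij_inj p_bij.

Lemma vidx_inj : injective (@vidx r n).
Proof.
move=> [i j] [i' j'] E; have [g gK _] := curry_mxvec_bij r n.
by rewrite -[(i, j)]gK ?inE // -[(i', j')]gK ?inE //; congr g.
Qed.

Lemma vidx_surj l : exists v, l = vidx v.
Proof. by case/mxvec_indexP: l => i j; exists (i, j). Qed.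

Lemma lvlE (i : 'I_r) : lvl i = i.+1 :> nat.
Proof. by rewrite /= /bump add1n. Qed.

Lemma multichainP I : reflect
  [/\ I ord0 = set0, I ord_max = setT,
      forall l x y, x \in I l -> (y <= x)%O -> y \in I l &
      forall k l : 'I_r.+1, (k <= l)%N -> I k \subset I l]
  (is_multichain I).
Proof.
apply: (iffP and4P) => [[/eqP I0 /eqP Ir /forallP id /forallP mon]|[I0 Ir id mon]].
  split=> // [l z y zI yz|k l kl].
    by have /forallP/(_ z)/implyP/(_ zI)/forallP/(_ y)/implyP/(_ yz) := id l.
  by have /forallP/(_ l)/implyP/(_ kl) := mon k.
split; rewrite ?I0 ?Ir //.
  apply/forallP => l; apply/forallP => z; apply/implyP => zI.
  by apply/forallP => y; apply/implyP; apply: id zI.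
by apply/forallP => k; apply/forallP => l; apply/implyP; apply: mon.
Qed.

Lemma level_le I j (l : 'I_r.+1) : is_multichain I -> (level p I j <= l)%N = (p j \in I l).
Proof.
case/multichainP=> _ Ir _ mon; rewrite /level.
case: arg_minnP => [|k pk k_min]; first by rewrite Ir inE.
by apply/idP/idP => [/mon/subsetP->|/k_min].
Qed.

Lemma lvl_level_row I m j : is_multichain I -> lvl (level_row p I m j) = level p I j.
Proof.
move=> HI; rewrite /level_row; case: unliftP => [k ->//|E].
by have := level_le j ord0 HI; rewrite E leqnn; case/multichainP: HI => ->; rewrite inE.
Qed.

Lemma level_row_le I m j (i : 'I_r) : is_multichain I ->
  (level_row p I m j <= i)%N = (p j \in I (lvl i)).
Proof. by move=> HI; rewrite -level_le // -(lvl_level_row m) // !lvlE ltnS. Qed.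

(** The row of p_j is determined by the levels that contain p_j. *)
Lemma level_row_unique I m j i :
    is_multichain I -> (forall l : 'I_r.+1, (p j \in I l) = (lvl i <= l)%N) ->
  level_row p I m j = i.
Proof.
move=> HI E; apply/val_inj/eqP; rewrite eqn_leq level_row_le // E leqnn /=.
by rewrite -ltnS -2!lvlE -E lvl_level_row // -level_le.
Qed.

(** The exponent of x_ij in u_I is 1 if p_j first appears in the ideal of row
    i, and 0 otherwise. *)
Lemma umonE I m i j : is_multichain I ->
  umon p I (vidx (i, j)) = (level_row p I m j == i).
Proof.
move=> HI; have -> : umon p I (vidx (i, j)) =
    (p j \in I (lvl i) :\: I (lvl_pred i)) :> nat.
  rewrite mnm_sumE (bigD1 i) //= mnm_sumE big_mkcond (bigD1 j) //= mnm1E eqxx.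
  rewrite big1 => [|j' jj']; last first.
    case: ifP => // _; rewrite mnm1E (inj_eq vidx_inj) xpair_eqE eqxx.
    by rewrite (negPf jj').
  rewrite big1 => [|i' ii']; first by rewrite !addn0; case: ifP.
  rewrite mnm_sumE big1 // => j' _; rewrite mnm1E (inj_eq vidx_inj) xpair_eqE.
  by rewrite (negPf ii').
rewrite inE -!level_le // -(lvl_level_row m) // !lvlE /=.
by rewrite -leqNgt -eqn_leq eq_sym.
Qed.

(** The variables x_mj such that p_j is minimal in the complement of I_m. *)
Definition corners I : {set var} :=
  [set v | (p v.2 \notin I (lvl v.1)) &&
           [forall q, (q < p v.2)%O ==> (q \in I (lvl v.1))]].

Lemma cornersP I v : reflect
  (p v.2 \notin I (lvl v.1) /\ forall q, (q < p v.2)%O -> q \in I (lvl v.1))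
  (v \in corners I).
Proof.
rewrite inE; apply: (iffP andP) => [[h /forallP h']|[h h']]; split=> //.
  by move=> q; apply/implyP.
by apply/forallP => q; apply/implyP/h'.
Qed.

(** The condition l < level may be dropped from the definition of the shifted
    multichain, since beyond that level p_j is present anyway. *)
Lemma shiftE I v (l : 'I_r.+1) : is_multichain I ->
  chain_shift p I v l = if (lvl v.1 <= l)%N then p v.2 |: I l else I l.
Proof.
move=> HI; rewrite ffunE; case: (leqP (lvl v.1) l) => // _.
case: (ltnP l (level p I v.2)) => //.
by rewrite level_le // => h; rewrite (setUidPr _) ?sub1set.
Qed.

Lemma mem_shift I v (l : 'I_r.+1) j : is_multichain I -> v \in corners I ->
  (p j \in chain_shift p I v l) = if j == v.2 then (lvl v.1 <= l)%N else p j \in I l.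
Proof.
move=> HI /cornersP[vI _]; rewrite shiftE //; have [->|jv] := eqVneq j v.2.
  case: (leqP (lvl v.1) l) => [_|lv]; first by rewrite setU11.
  apply/negbTE; apply: contra vI; apply/subsetP; case/multichainP: HI => _ _ _ ->//.
  exact: ltnW.
by case: ifP => // _; rewrite !inE (inj_eq p_inj) (negPf jv).
Qed.

Lemma shift_multichain I v : is_multichain I -> v \in corners I ->
  is_multichain (chain_shift p I v).
Proof.
move=> HI /cornersP[_ vI]; have [I0 Ir id mon] := multichainP _ HI.
apply/multichainP; split=> [|||k l kl]; rewrite ?shiftE //.
- by rewrite lvlE Ir; case: ifP => // _; apply/setP => q; rewrite !inE orbT.
- move=> l z y; rewrite !shiftE //; case: ifP => [vl|_]; last exact: id.
  rewrite !inE => /orP[/eqP->|zI yz]; last by rewrite (id _ _ _ zI yz) orbT.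
  rewrite le_eqVlt => /orP[->//|/vI yI].
  by rewrite (subsetP (mon _ _ vl)) ?orbT.
- have [vk|vk] := leqP (lvl v.1) k; first by rewrite (leq_trans vk kl) setUS ?mon.
  case: ifP => _; last exact: mon.
  by apply: subset_trans (mon _ _ kl) _; apply: subsetUr.
Qed.

Lemma level_row_shift I v m j : is_multichain I -> v \in corners I ->
  level_row p (chain_shift p I v) m j = if j == v.2 then v.1 else level_row p I m j.
Proof.
move=> HI vI; apply: level_row_unique => [|l]; first exact: shift_multichain.
rewrite mem_shift //; case: ifP => // _.
by rewrite lvl_level_row // level_le.
Qed.

(** The row of p_j in a multichain with corner x_mj lies strictly below m. *)
Lemma corner_lt_level I v m : is_multichain I -> v \in corners I ->
  (v.1 < level_row p I m v.2)%N.
Proof. by move=> HI /cornersP[vI _]; rewrite ltnNge level_row_le. Qed.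

(** u_{I'} = x_mj (u_I / x_tj). *)
Lemma umon_shift I v m : is_multichain I -> v \in corners I ->
  (umon p (chain_shift p I v) + U_(vidx (level_row p I m v.2, v.2)) =
   umon p I + U_(vidx v))%MM.
Proof.
move=> HI vI; apply/mnmP => l; have [[i j] ->] := vidx_surj l.
rewrite !mnmDE !mnm1E !(inj_eq vidx_inj) !(umonE m) ?shift_multichain //.
rewrite level_row_shift //.
have -> : (v == (i, j)) = (v.1 == i) && (v.2 == j) by case: (v).
rewrite xpair_eqE [j == _]eq_sym; case: (v.2 =P j) => [<-|_]; last by rewrite !andbF !addn0.
by rewrite !andbT addnC.
Qed.

Lemma umon_corner I v : is_multichain I -> v \in corners I -> umon p I (vidx v) = 0%N.
Proof.
move=> HI vI; rewrite [v]surjective_pairing (umonE v.1) //.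
by have := corner_lt_level v.1 HI vI; case: eqP => // ->; rewrite ltnn.
Qed.

Lemma lex_gt_shift I v : is_multichain I -> v \in corners I ->
  lex_gt (umon p (chain_shift p I v)) (umon p I).
Proof.
move=> HI vI; have E := umon_shift v.1 HI vI.
have lt := corner_lt_level v.1 HI vI; set t := (_, _) in E.
have Ew w : w != t -> w != v -> umon p (chain_shift p I v) (vidx w) = umon p I (vidx w).
  move=> /negPf wt /negPf wv; move/mnmP/(_ (vidx w)): E; rewrite !mnmDE !mnm1E.
  by rewrite !(inj_eq vidx_inj) ![_ == w]eq_sym wt wv !addn0.
apply/existsP; exists v; rewrite umon_corner //; apply/andP; split.
  by rewrite [v in vidx v]surjective_pairing (umonE v.1) ?shift_multichain // level_row_shift ?eqxx.
apply/forallP => w; apply/implyP => wv; apply/eqP/Ew; apply: contraTneq wv => ->.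
  by rewrite /var_gt /= ltnNge (ltnW lt) -val_eqE /= gtn_eqF.
by rewrite /var_gt !ltnn andbF.
Qed.

(** If J is not contained in I then some corner variable of I divides u_J but
    not u_I: in the first level l with J_l not contained in I_l, take the
    element of J_l \ I_l with the least label. *)
Lemma exists_corner I J : is_multichain I -> is_multichain J ->
    ~ (forall l, J l \subset I l) ->
  exists2 v, v \in corners I & umon p J (vidx v) = 1%N.
Proof.
move=> HI HJ JI.
have [I0 _ _ Imon] := multichainP _ HI; have [J0 _ Jid Jmon] := multichainP _ HJ.
have [l0 nl0] : exists l, ~~ (J l \subset I l).
  by apply/existsP; rewrite -negb_forall; apply/forallP.
case: (arg_minnP (P := fun l => ~~ (J l \subset I l)) (fun l : 'I_r.+1 => l : nat) nl0) => l nl l_min.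
have [m lm] : exists m, l = lvl m.
  case: (unliftP ord0 l) => [m ->|E]; first by exists m.
  by move: nl; rewrite E J0 sub0set.
have [q qJ qI] := subsetPn nl; have [p' pK p'K] := p_bij.
have j0P : (p (p' q) \in J l) && (p (p' q) \notin I l) by rewrite p'K qJ.
case: (arg_minnP (P := fun j => (p j \in J l) && (p j \notin I l)) (fun j : 'I_n => j : nat) j0P).
move=> j /andP[jJ jI] j_min; exists (m, j).
  apply/cornersP; split=> /=; rewrite -lm // => q' q'j; apply/negPn/negP => q'I.
  have /p_label : (p (p' q') < p j)%O by rewrite p'K.
  by rewrite ltnNge j_min // p'K q'I (Jid _ _ _ jJ (ltW q'j)).
rewrite (umonE m) //; apply/eqP; rewrite eqb1 -val_eqE /= eqn_leq.
rewrite level_row_le // -lm jJ /= -ltnS -[X in (_ < X)%N]lvlE lvl_level_row //.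
rewrite ltnNge (level_le j (lvl_pred m)) //; apply/negP => jJ'.
have /negPn/subsetP/(_ _ jJ') : ~~ ~~ (J (lvl_pred m) \subset I (lvl_pred m)).
  by apply/negP => /l_min; rewrite lm lvlE /= ltnn.
apply/negP; apply: contra jI; apply/subsetP/Imon; rewrite lm lvlE /=; exact: leqnSn.
Qed.

Lemma lex_gt_not_sub I J : is_multichain I -> is_multichain J ->
  lex_gt (umon p J) (umon p I) -> ~ (forall l, J l \subset I l).
Proof.
move=> HI HJ /existsP[[m j] /andP[lt /forallP eqw]] JI.
move: lt; rewrite !(umonE m) //.
case: (level_row p I m j =P m) => Im; first by case: (_ == _).
case: (level_row p J m j =P m) => // Jm _.
have jI : p j \in I (lvl m).
  by apply: (subsetP (JI _)); rewrite -(level_row_le m) // Jm.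
have := eqw (level_row p I m j, j); rewrite !(umonE m) // eqxx Jm /var_gt /=.
rewrite ltnn andbF orbF ltn_neqAle level_row_le // jI andbT.
by move/eqP/negPf: Im => Im; rewrite val_eqE Im /= [m == _]eq_sym Im.
Qed.

Lemma corner_dvd_eq v I J w : is_multichain I ->
  (umon p J <= U_(vidx v) + umon p I)%MM ->
  w \in corners I -> umon p J (vidx w) = 1%N -> w = v.
Proof.
move=> HI /mnm_lepP/(_ (vidx w)) le wI Jw; move: le.
rewrite mnmDE mnm1E Jw umon_corner // addn0 (inj_eq vidx_inj).
by case: eqP.
Qed.

Lemma var_mul_u (v : var) I : x K v * u K p I = 'X_[U_(vidx v) + umon p I].
Proof. by rewrite mpolyXD. Qed.

Lemma shift_u I v m : is_multichain I -> v \in corners I ->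
  x K (level_row p I m v.2, v.2) * u K p (chain_shift p I v) = x K v * u K p I.
Proof. by move=> HI vI; rewrite !var_mul_u addmC umon_shift // addmC. Qed.

(** The variables in the colon ideal are the corners. *)
Theorem set_uE I : is_multichain I -> set_u K p I = corners I.
Proof.
move=> HI; apply/setP => v; rewrite [LHS]inE.
apply/idP/idP => [h|vI]; last first.
  rewrite -(shift_u v.1) //; apply: lspanZ; apply: lspan_gen.
  by exists (chain_shift p I v); split; rewrite ?shift_multichain ?lex_gt_shift.
pose A m := exists J, [/\ is_multichain J, lex_gt (umon p J) (umon p I) & m = umon p J].
have hA m : m \in msupp (x K v * u K p I) -> exists2 m', A m' & (m' <= m)%MM.
  move: m; apply: (lspan_monomials _ _).1 h => z.
  split=> [[J [HJ JI ->]]|[_ [J [HJ JI ->]] ->]]; last by exists J.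
  by exists (umon p J) => //; exists J.
have [|_ [J [HJ JI ->]] le] := hA (U_(vidx v) + umon p I)%MM.
  by rewrite var_mul_u msuppX inE.
have [w wI Jw] := exists_corner HI HJ (lex_gt_not_sub HI HJ JI).
by rewrite -(corner_dvd_eq HI le wI Jw).
Qed.

(** A corner survives the shift at another one, unless it lies below it in the
    same column. *)
Lemma corner_shift I v w : is_multichain I -> v \in corners I -> w \in corners I ->
  w != v -> (w \in corners (chain_shift p I v)) = ~~ ((w.2 == v.2) && (v.1 < w.1)%N).
Proof.
move=> HI vI /cornersP[wI wI'] wv; rewrite inE mem_shift // !lvlE ltnS.
have -> : [forall q, (q < p w.2)%O ==> (q \in chain_shift p I v (lvl w.1))].
  apply/forallP => q; apply/implyP => /wI' qI; rewrite shiftE //.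
  by case: ifP => // _; rewrite !inE qI orbT.
rewrite andbT; case: eqP => /= [E|_] //; congr (~~ _); rewrite leq_eqVlt.
case: eqP => //= /val_inj E'; case/eqP: wv.
by rewrite [w]surjective_pairing [v]surjective_pairing E E'.
Qed.

Lemma shift_comm I v w : is_multichain I ->
    v \in corners I -> w \in corners I ->
    v \in corners (chain_shift p I w) -> w \in corners (chain_shift p I v) ->
  chain_shift p (chain_shift p I v) w = chain_shift p (chain_shift p I w) v.
Proof.
move=> HI vI wI vIw wIv; apply/ffunP => l; rewrite !shiftE ?shift_multichain //.
by case: leqP => _; case: leqP => _ //; rewrite setUCA.
Qed.

(** In a common column, the shift in the upper row absorbs the lower one. *)
Lemma shift_absorb I v w : is_multichain I ->
    v \in corners I -> w \in corners I -> w.2 = v.2 -> (v.1 < w.1)%N ->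
  chain_shift p (chain_shift p I w) v = chain_shift p I v.
Proof.
move=> HI vI wI E lt; apply/ffunP => l; rewrite !shiftE ?shift_multichain // E !lvlE.
case: (ltnP v.1 l) => [_|lv]; first by case: ifP => // _; rewrite setUA setUid.
by rewrite ltnNge (leq_trans lv (ltnW lt)).
Qed.

(** Filtration parameter: shifting at a corner enlarges the multichain. *)
Definition chain_size I : nat := (\sum_l #|I l|)%N.

Lemma chain_size_shift I v : is_multichain I -> v \in corners I ->
  (chain_size I < chain_size (chain_shift p I v))%N.
Proof.
move=> HI /cornersP[vI _]; rewrite /chain_size (bigD1 (lvl v.1)) //=.
rewrite [X in (_ < X)%N](bigD1 (lvl v.1)) //= -addSn leq_add //.
  by rewrite shiftE // leqnn cardsU1 vI.
apply: leq_sum => l _; rewrite shiftE //; case: ifP => // _.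
exact/subset_leq_card/subsetUr.
Qed.

Lemma chain_size_sub I J : (chain_size I <= chain_size J)%N ->
  (forall l, J l \subset I l) -> J = I.
Proof.
move=> le JI; apply/ffunP => l; apply/eqP; rewrite eqEcard JI /= leqNgt.
apply: contraL le => lt; rewrite -ltnNge /chain_size (bigD1 l) //=.
rewrite [X in (_ < X)%N](bigD1 l) //= -addSn leq_add //.
by apply: leq_sum => l' _; apply/subset_leq_card.
Qed.

Lemma chain_size_bound I : (chain_size I <= r.+1 * #|P|)%N.
Proof.
rewrite -[X in (X * _)%N]card_ord -sum_nat_const; apply: leq_sum => l _.
exact: max_card.
Qed.

End Multichains.

(** * The differential squares to zero *)

(** The order of the variables as an injective numbering. *)
Definition enc (r n : nat) (v : var r n) : nat := (v.1 * n + v.2)%N.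

Lemma enc_lt r n (v w : var r n) : (enc v < enc w)%N = var_gt v w.
Proof.
case: v w => [i j] [i' j']; rewrite /enc /var_gt /=.
have [lt|lt|/val_inj ->] /= := ltngtP i i'.
- apply: leq_trans (leq_addr _ _); apply: leq_trans (_ : i.+1 * n <= _)%N.
    by rewrite mulSn addnC ltn_add2r.
  by rewrite leq_mul2r lt orbT.
- rewrite -val_eqE /= gtn_eqF //=; apply/negbTE; rewrite -leqNgt.
  apply: leq_trans (leq_addr _ _); apply: leq_trans (_ : i'.+1 * n <= _)%N.
    by rewrite mulSn addnC leq_add2r ltnW.
  by rewrite leq_mul2r lt orbT.
- by rewrite eqxx ltn_add2l.
Qed.

Lemma enc_inj r n : injective (@enc r n).
Proof.
move=> v w E; have := enc_lt v w; have := enc_lt w v; rewrite E ltnn /var_gt.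
case: v w {E} => [i j] [i' j'] /=; case: (ltngtP i i') => //= /val_inj ->.
by rewrite !eqxx /=; case: (ltngtP j j') => //= /val_inj ->.
Qed.

Lemma alphaE r n (s : {set var r n}) v : alpha s v = ksign (@enc r n) s v.
Proof. by apply: eq_card => w; rewrite !inE enc_lt. Qed.

Section Sign.
Variables (T : finType) (enc : T -> nat).
Hypothesis enc_inj : injective enc.

Lemma ksign_swap (R : comNzRingType) (s : {set T}) v w : v \in s -> w \in s -> v != w ->
  (-1) ^+ ksign enc s v * (-1) ^+ ksign enc (s :\ v) w =
  - ((-1) ^+ ksign enc s w * (-1) ^+ ksign enc (s :\ w) v) :> R.
Proof.
suff H u u' : u \in s -> u' \in s -> (enc u < enc u')%N ->
    (-1) ^+ ksign enc s u * (-1) ^+ ksign enc (s :\ u) u' =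
    - ((-1) ^+ ksign enc s u' * (-1) ^+ ksign enc (s :\ u') u) :> R.
  move=> vs ws vw; have [lt|lt|/enc_inj E] := ltngtP (enc v) (enc w).
  - exact: H.
  - by rewrite (H w v) ?opprK.
  - by rewrite E eqxx in vw.
move=> us us' lt.
have -> : ksign enc s u' = (ksign enc (s :\ u) u').+1.
  rewrite /ksign (cardsD1 u) inE us lt; congr _.+1; apply: eq_card => x.
  by rewrite !inE andbA.
have -> : ksign enc (s :\ u') u = ksign enc s u.
  apply: eq_card => x; rewrite !inE; case: eqP => // ->.
  by rewrite ltnNge ltnW ?andbF.
by rewrite exprS mulN1r mulNr opprK mulrC.
Qed.

(** A double sum over ordered pairs of distinct elements of a quantity that is
    odd under exchange vanishes, in any characteristic. *)
Lemma sum_pairs_odd (V : zmodType) (s : {set T}) (F : T -> T -> V) :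
    (forall v w, v \in s -> w \in s -> v != w -> F v w + F w v = 0) ->
  \sum_(v in s) \sum_(w in s :\ v) F v w = 0.
Proof.
move=> Fodd; pose lt v w := [&& v \in s, w \in s & (enc v < enc w)%N].
have E : \sum_(v in s) \sum_(w in s :\ v) F v w =
    \sum_v \sum_(w | lt v w) F v w + \sum_v \sum_(w | lt w v) F v w.
  rewrite big_mkcond -big_split; apply: eq_bigr => v _ /=.
  case: ifP => vs; last by rewrite !big_pred0 ?addr0 // => w; rewrite /lt vs ?andbF.
  rewrite (bigID (fun w => (enc v < enc w)%N)) /=; congr (_ + _).
    apply: eq_bigl => w; rewrite !inE /lt vs /=; case: eqP => [->|//].
    by rewrite ltnn !andbF.
  apply: eq_bigl => w; rewrite !inE /lt vs /=; have [->|wv] := eqVneq w v.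
    by rewrite ltnn !andbF.
  congr (_ && _); rewrite -leqNgt leq_eqVlt.
  by case: eqP => // /enc_inj E; rewrite E eqxx in wv.
rewrite E [X in _ + X](exchange_big_dep xpredT) //= -big_split big1 // => v _ /=.
rewrite -big_split big1 // => w /and3P[vs ws vw]; apply: Fodd => //.
by apply: contraTneq vw => ->; rewrite ltnn.
Qed.

End Sign.

Lemma scale_swap (R : comNzRingType) (M : lmodType R) (A B V W : R) (a b c d : M) :
  A *: (B *: a - W *: b) - V *: (B *: c - W *: d) =
  B *: (A *: a - V *: c) - W *: (A *: b - V *: d).
Proof.
rewrite !scalerBr !scalerA (mulrC B A) (mulrC B V) (mulrC W A) (mulrC W V).
by rewrite !opprB addrACA [RHS]addrACA; congr (_ + _); apply: addrC.
Qed.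

Lemma scale_absorb (R : comNzRingType) (M : lmodType R) (T V W : R) (b c d : M) :
  T *: (W *: b - V *: c) - W *: (T *: b - V *: d) = - (V *: (T *: c - W *: d)).
Proof.
rewrite !scalerBr !scalerA (mulrC W T) (mulrC T V) (mulrC W V).
by rewrite !opprB addrC subrKA.
Qed.

Section Differential.
Variables (K : fieldType) (r n : nat).
Variables (disp : Order.disp_t) (P : finPOrderType disp) (p : 'I_n -> P).
Hypotheses (p_bij : bijective p).
Local Notation S := {mpoly K[r * n]}.
Local Notation var := (var r n).
Local Notation chain := {ffun 'I_r.+1 -> {set P}}.
Local Notation row := (level_row p).
Implicit Types (I J : chain) (v w : var) (s : {set var}).

(** The right-hand side of the formula for the differential, for an arbitrary
    family of symbols [f] in a module. *)
Definition bd (M : lmodType S) (f : {set var} -> chain -> M) s I : M :=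
  \sum_(v in s) (-1) ^+ alpha s v *:
     (x K (row I v.1 v.2, v.2) *: f (s :\ v) (chain_shift p I v) - x K v *: f (s :\ v) I).

Lemma row_default I m m' j : is_multichain I -> row I m j = row I m' j.
Proof. by move=> HI; apply: (@lift_inj _ ord0); rewrite -!/(lvl _) !lvl_level_row. Qed.

Lemma sub_shift I v l : is_multichain I -> I l \subset chain_shift p I v l.
Proof.
by move=> HI; rewrite shiftE //; case: ifP => // _; apply: subsetUr.
Qed.

Section Square.
Variables (M : lmodType S) (f : {set var} -> chain -> M).
Hypothesis f0 : forall s I, is_multichain I -> ~~ (s \subset corners p I) -> f s I = 0.

(** The family [bd f], set to 0 on the pairs that are not symbols. *)
Definition bd_corner s I : M := if s \subset corners p I then bd f s I else 0.

Variables (I : chain) (s : {set var}).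
Hypotheses (HI : is_multichain I) (sI : s \subset corners p I).
Local Notation shift := (chain_shift p I).

Let cI v : v \in s -> v \in corners p I := subsetP sI v.
Let HIs v : v \in s -> is_multichain (shift v) := fun vs => shift_multichain HI (cI vs).

(** The contribution to bd_corner composed with bd of removing v, then w. *)
Definition bd2 v w : M := let t := s :\ v :\ w in
  x K (row I v.1 v.2, v.2) *:
    (if s :\ v \subset corners p (shift v) then
       x K (row (shift v) w.1 w.2, w.2) *: f t (chain_shift p (shift v) w)
       - x K w *: f t (shift v) else 0)
  - x K v *: (x K (row I w.1 w.2, w.2) *: f t (shift w) - x K w *: f t I).

Lemma not_corners_shift v : v \in s -> ~~ (s :\ v \subset corners p (shift v)) ->
  exists z, [/\ z \in s, z != v, z.2 = v.2, (v.1 < z.1)%N & z \notin corners p (shift v)].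
Proof.
move=> vs /subsetPn[z]; rewrite in_setD1 => /andP[zv zs] zI; exists z.
have /andP[/eqP z2 z1] : (z.2 == v.2) && (v.1 < z.1)%N.
  by move: zI; rewrite corner_shift ?cI // negbK.
by [].
Qed.

(** The test in [bd2] may be dropped unless w lies below v in the same column:
    any other obstruction z remains after w is removed, and kills both terms. *)
Lemma bd2E v w : v \in s -> w \in s -> w != v -> ~~ ((w.2 == v.2) && (v.1 < w.1)%N) ->
  bd2 v w = let t := s :\ v :\ w in
  x K (row I v.1 v.2, v.2) *:
    (x K (row (shift v) w.1 w.2, w.2) *: f t (chain_shift p (shift v) w)
       - x K w *: f t (shift v))
  - x K v *: (x K (row I w.1 w.2, w.2) *: f t (shift w) - x K w *: f t I).
Proof.
move=> vs ws wv cond; rewrite /bd2 /=; case: ifP => // /negbT.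
case/(not_corners_shift vs) => z [zs zv z2 z1 zI]; congr (_ *: _ - _).
have wI : w \in corners p (shift v) by rewrite corner_shift ?cI.
have zw : z != w by apply: contraNneq cond => <-; rewrite z2 eqxx z1.
have zt : z \in s :\ v :\ w by rewrite !in_setD1 zw zv zs.
rewrite !f0 ?scaler0 ?subrr //.
- exact: HIs.
- by apply: contra zI => /subsetP; apply.
- exact: shift_multichain (HIs vs) wI.
have zin : p z.2 \in shift v (lvl z.1).
  by rewrite mem_shift ?cI // z2 eqxx !lvlE ltnS ltnW.
apply/negP => /subsetP/(_ _ zt)/cornersP[/negP[]].
by apply: (subsetP (sub_shift _ _ (HIs vs))).
Qed.

Lemma bd2C v w : v \in s -> w \in s -> v != w -> bd2 v w = bd2 w v.
Proof.
have tE u u' : s :\ u :\ u' = s :\ u' :\ u.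
  by apply/setP => z; rewrite !inE andbCA.
have absorb u u' : u \in s -> u' \in s -> u'.2 = u.2 -> (u.1 < u'.1)%N -> bd2 u u' = bd2 u' u.
  move=> us us' E lt.
  have uu' : u' != u by apply: contraTneq lt => ->; rewrite ltnn.
  rewrite [RHS]bd2E // 1?eq_sym //; last by rewrite negb_and -leqNgt ltnW ?orbT.
  rewrite /bd2 /= tE; case: ifP => [/subsetP/(_ u')|_].
    rewrite in_setD1 uu' us' corner_shift ?cI // E eqxx lt => /(_ isT)//.
  rewrite (shift_absorb HI (cI us) (cI us') E lt).
  have -> : row (shift u') u.1 u.2 = u'.1 by rewrite level_row_shift ?cI // E eqxx.
  have -> : (u'.1, u.2) = u' by rewrite -E -surjective_pairing.
  have -> : (row I u'.1 u'.2, u'.2) = (row I u.1 u.2, u.2).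
    by rewrite E (row_default u'.1 u.1).
  by rewrite scaler0 sub0r scale_absorb.
move=> vs ws vw; have [E|E] := eqVneq v.2 w.2.
  have [lt|lt|E1] := ltngtP v.1 w.1; first exact: absorb.
    by rewrite (absorb w v).
  case/eqP: vw; rewrite [v]surjective_pairing [w]surjective_pairing E.
  by rewrite (val_inj E1).
have Ev : ~~ ((w.2 == v.2) && (v.1 < w.1)%N) by rewrite eq_sym (negPf E).
have Ew : ~~ ((v.2 == w.2) && (w.1 < v.1)%N) by rewrite (negPf E).
rewrite !bd2E // 1?eq_sym //= tE.
have vIw : v \in corners p (shift w) by rewrite corner_shift ?cI.
have wIv : w \in corners p (shift v) by rewrite corner_shift ?cI // eq_sym.
rewrite (shift_comm HI (cI vs) (cI ws) vIw wIv) !level_row_shift ?cI //.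
by rewrite (negPf E) eq_sym (negPf E) scale_swap.
Qed.

Lemma bd_bd : bd bd_corner s I = 0.
Proof.
pose sg (s' : {set var}) v : S := (-1) ^+ alpha s' v.
transitivity (\sum_(v in s) \sum_(w in s :\ v) (sg s v * sg (s :\ v) w) *: bd2 v w).
  apply: eq_bigr => v vs; rewrite /bd_corner.
  have -> : s :\ v \subset corners p I by apply: subset_trans sI; apply: subD1set.
  rewrite (_ : (if _ then _ else _) = \sum_(w in s :\ v) sg (s :\ v) w *:
    (if s :\ v \subset corners p (shift v) then
       x K (row (shift v) w.1 w.2, w.2) *: f (s :\ v :\ w) (chain_shift p (shift v) w)
       - x K w *: f (s :\ v :\ w) (shift v) else 0)); last first.
    by case: ifP => // _; rewrite big1 // => w _; rewrite scaler0.
  rewrite !scaler_sumr -sumrB scaler_sumr; apply: eq_bigr => w _.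
  rewrite -scalerA; congr (_ *: _); rewrite /bd2 [RHS]scalerBr.
  by congr (_ - _); rewrite -?scalerBr !scalerA mulrC.
apply: (sum_pairs_odd (@enc_inj r n)) => v w vs ws vw.
rewrite (bd2C vs ws vw) -scalerDl /sg !alphaE.
by rewrite (ksign_swap (@enc_inj r n)) // addNr scale0r.
Qed.

End Square.
End Differential.

(** * The complex *)

Section Complex.
Variables (K : fieldType) (r n : nat).
Variables (disp : Order.disp_t) (P : finPOrderType disp) (p : 'I_n -> P).
Hypotheses (p_bij : bijective p).
Hypothesis p_label : forall i j : 'I_n, (p i < p j)%O -> (i < j)%N.
Local Notation S := {mpoly K[r * n]}.
Local Notation var := (var r n).
Local Notation chain := {ffun 'I_r.+1 -> {set P}}.
Implicit Types (I J : chain) (v w : var) (s t : {set var}).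

Local Notation sym i := {b : {set var} * chain | is_symbol K p i b}.

(** The free module on the symbols f(s; u_I) with #|s| = i; it is the module
    in homological degree i + 1. *)
Definition free (i : nat) : lmodType S := {ffun sym i -> S^o}.

(** The basis element f(s; u_I), or 0 when (s, I) is not a symbol. *)
Definition symb i s I : free i := [ffun b => (val b == (s, I))%:R].

Lemma is_symbolE i s I :
  is_symbol K p i (s, I) = [&& is_multichain I, s \subset corners p I & #|s| == i].
Proof.
rewrite /is_symbol /=; case HI: (is_multichain I) => //=.
by rewrite (set_uE K p_bij p_label HI).
Qed.

Lemma symP i (b : sym i) :
  [/\ is_multichain (val b).2, (val b).1 \subset corners p (val b).2 & #|(val b).1| = i].
Proof.
case: b => [[s I] Hb] /=; have := Hb; rewrite is_symbolE.
by case/and3P => ? ? /eqP.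
Qed.

Lemma symb_eq0 i s I : ~~ is_symbol K p i (s, I) -> symb i s I = 0.
Proof.
move=> h; apply/ffunP => b; rewrite !ffunE; case: eqP => // E.
by rewrite -E (valP b) in h.
Qed.

Lemma symb_val i (b b' : sym i) : symb i (val b).1 (val b).2 b' = (b' == b)%:R.
Proof. by rewrite ffunE -surjective_pairing (inj_eq val_inj). Qed.

Lemma free_sum i (a : sym i -> S) b :
  (\sum_b' a b' *: symb i (val b').1 (val b').2) b = a b.
Proof.
rewrite sum_ffunE (bigD1 b) //= big1 => [|b' b'b]; last first.
  by rewrite ffunE symb_val eq_sym (negPf b'b) scaler0.
by rewrite addr0 ffunE symb_val eqxx; apply: mulr1.
Qed.

Lemma symb_basis i : is_basis (fun b : sym i => symb i (val b).1 (val b).2).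
Proof.
split=> [y|a a0 b].
  by exists y; apply/ffunP => b; rewrite free_sum.
by rewrite -free_sum a0 ffunE.
Qed.

Section Extend.
Variables (M : lmodType S) (i : nat) (g : {set var} -> chain -> M).

(** The module map defined on the basis by symb s I |-> g s I. *)
Definition ext_fun (z : free i) : M := \sum_b z b *: g (val b).1 (val b).2.

Lemma ext_fun_linear : linear ext_fun.
Proof.
move=> c y z; rewrite scaler_sumr -big_split /=; apply: eq_bigr => b _.
by rewrite !ffunE scalerDl scalerA.
Qed.

HB.instance Definition _ := GRing.isLinear.Build S (free i) M *:%R ext_fun ext_fun_linear.

Lemma ext_symb s I : ext_fun (symb i s I) = if is_symbol K p i (s, I) then g s I else 0.
Proof.
case: ifP => [Hb|/negbT/symb_eq0->]; last exact: linear0.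
rewrite /ext_fun (bigD1 (Sub (s, I) Hb)) //= ffunE eqxx scale1r big1 ?addr0 // => b.
by rewrite ffunE -val_eqE /= => /negPf->; rewrite scale0r.
Qed.

End Extend.

Definition dif (i : nat) : {linear free i.+1 -> free i} := ext_fun (bd p (symb i)).
Definition dif0 : {linear free 0 -> S^o} := ext_fun (fun _ I => u K p I : S^o).

Lemma difE i z :
  dif i z = \sum_b z b *: bd p (symb i) (val b).1 (val b).2.
Proof. by []. Qed.

Lemma dif0E z : dif0 z = \sum_b z b *: (u K p (val b).2 : S^o).
Proof. by []. Qed.

Lemma bd_linear (M M' : lmodType S) (phi : {linear M -> M'}) (f : {set var} -> chain -> M) s I :
  phi (bd p f s I) = bd p (fun s I => phi (f s I)) s I.
Proof.
rewrite linear_sum; apply: eq_bigr => v _.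
by rewrite linearZ linearB !linearZ.
Qed.

Lemma bd_ext (M : lmodType S) (f g : {set var} -> chain -> M) s I :
    (forall v, v \in s -> f (s :\ v) (chain_shift p I v) = g (s :\ v) (chain_shift p I v)) ->
    (forall v, v \in s -> f (s :\ v) I = g (s :\ v) I) ->
  bd p f s I = bd p g s I.
Proof. by move=> fg1 fg2; apply: eq_bigr => v vs; rewrite fg1 // fg2. Qed.

Lemma symb_corner0 i s I : is_multichain I -> ~~ (s \subset corners p I) -> symb i s I = 0.
Proof. by move=> HI h; rewrite symb_eq0 // is_symbolE (negPf h) andbF. Qed.

Lemma dif_dif i z : dif i (dif i.+1 z) = 0.
Proof.
rewrite [dif i.+1 z]difE linear_sum big1 // => b _; rewrite linearZ_LR.
have [HI sI si] := symP b; rewrite bd_linear.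
rewrite (@bd_ext _ _ (bd_corner p (symb i))) ?(bd_bd p_bij (@symb_corner0 i)) ?scaler0 //.
  move=> v vs; rewrite /dif /= ext_symb is_symbolE /bd_corner shift_multichain ?(subsetP sI) //=.
  by move: si; rewrite (cardsD1 v) vs add1n => -[->]; rewrite eqxx andbT.
move=> v vs; rewrite /dif /= ext_symb is_symbolE /bd_corner HI /=.
by move: si; rewrite (cardsD1 v) vs add1n => -[->]; rewrite eqxx andbT.
Qed.

Lemma dif0_dif z : dif0 (dif 0 z) = 0.
Proof.
rewrite [dif 0 z]difE linear_sum big1 // => b _; rewrite linearZ_LR.
have [HI sI si] := symP b; rewrite bd_linear /bd big1 ?scaler0 // => v vs.
have s1 : #|(val b).1 :\ v| = 0%N by move: si; rewrite (cardsD1 v) vs => -[].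
have vI := subsetP sI v vs.
rewrite /dif0 /= !ext_symb !is_symbolE HI shift_multichain // (cards0_eq s1) !sub0set cards0 /=.
rewrite (_ : x K _ *: _ = x K v *: (u K p (val b).2 : S^o)) ?subrr ?scaler0 //.
exact: shift_u.
Qed.

(** ** Exactness *)

(** The coefficients of a chain as a function on all pairs. *)
Definition coef i (z : free i) I s : S :=
  if insub (s, I) is Some b then z (b : sym i) else 0.

Lemma coefE i (z : free i) I s : \sum_b z b * (val b == (s, I))%:R = coef z I s.
Proof.
rewrite /coef; case: insubP => [b _ <-|h].
  rewrite (bigD1 b) //= eqxx mulr1 big1 ?addr0 // => b' b'b.
  by rewrite (inj_eq val_inj) (negPf b'b) mulr0.
rewrite big1 // => b _; case: eqP => [E|_]; last exact: mulr0.
by rewrite -E (valP b) in h.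
Qed.

Lemma coef_val i (z : free i) (b : sym i) : coef z (val b).2 (val b).1 = z b.
Proof. by rewrite /coef -surjective_pairing valK. Qed.

Lemma coef_kchain i (z : free i) I : kchain (corners p I) i (coef z I).
Proof.
move=> s; rewrite /coef; case: insubP => [b|_]; last by rewrite eqxx.
by rewrite is_symbolE => /and3P[_ ? /eqP].
Qed.

(** Chains on multichains of size at least k. *)
Definition supp_ge i k (z : free i) : Prop :=
  forall b, z b != 0 -> (k <= chain_size (val b).2)%N.

(** On multichains of the least size k the differential is, up to sign, the
    Koszul differential, because shifts strictly increase the size. *)
Lemma dif_lead i k (z : free i.+1) (b' : sym i) :
    supp_ge k z -> (chain_size (val b').2 <= k)%N ->
  dif i z b' = - kd (@enc r n) (@vidx r n) (coef z (val b').2) (val b').1.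
Proof.
move=> zk b'k; set s' := (val b').1; set I' := (val b').2.
have b'E : val b' = (s', I') by rewrite -surjective_pairing.
transitivity (\sum_(b : sym i.+1) \sum_(v in (val b).1)
    - (z b * ((-1) ^+ alpha (val b).1 v * x K v * (((val b).1 :\ v, (val b).2) == (s', I'))%:R))).
  rewrite difE sum_ffunE; apply: eq_bigr => b _; rewrite ffunE sum_ffunE.
  rewrite [LHS]mulr_sumr; apply: eq_bigr => v vs.
  have [HI sI si] := symP b.
  rewrite !ffunE b'E ![(s', I') == _]eq_sym.
  have [->|/zk bk] := eqVneq (z b) 0; first by rewrite !mul0r oppr0.
  rewrite [(_, chain_shift _ _ _) == _](_ : _ = false); last first.
    apply/negbTE; apply: contraTneq b'k => -[_ E]; rewrite -ltnNge -/I' -E.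
    by apply: leq_ltn_trans bk (chain_size_shift _ _); rewrite ?(subsetP sI).
  rewrite scaler0 sub0r -[RHS]mulrN; congr (_ * _).
  by rewrite scalerN; congr (- _); apply: mulrA.
rewrite (exchange_big_dep xpredT) //= -sumrN [RHS]big_mkcond; apply: eq_bigr => v _.
rewrite -coefE mulr_sumr big_mkcond; case: ifP => vs' /=; last first.
  rewrite big1 // => b _; case: ifP => // vs; case: eqP => [[E _]|_].
    by move: vs'; rewrite -E !inE eqxx.
  by rewrite !mulr0 oppr0.
rewrite -sumrN; apply: eq_bigr => b _.
have -> : (val b == (v |: s', I')) =
    (v \in (val b).1) && (((val b).1 :\ v, (val b).2) == (s', I')).
  rewrite [val b]surjective_pairing !xpair_eqE andbA; congr (_ && _).
  apply/eqP/andP => [->|[vs /eqP<-]]; last by rewrite setD1K.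
  by rewrite setU11 setU1K.
case: ifP => vs /=; last by rewrite !mulr0 oppr0.
case: eqP => [[E _]|_]; last by rewrite !mulr0 oppr0.
rewrite !mulr1 mulrC alphaE; congr (- ((-1) ^+ _ * _ * _)).
by rewrite -E; apply: eq_card => w; rewrite !inE; case: eqP => [->|]; rewrite ?ltnn ?andbF.
Qed.

(** A cycle: in degree 0 the condition is with respect to the map to S. *)
Definition cycle i : free i -> Prop :=
  match i with 0 => fun z => dif0 z = 0 | j.+1 => fun z => dif j z = 0 end.

Lemma cycleB i (y z : free i) : cycle y -> cycle z -> cycle (y - z).
Proof. by case: i y z => [|i] y z hy hz; rewrite /cycle linearB hy hz subrr. Qed.

Lemma cycle_dif i z : cycle (dif i z).
Proof. by case: i z => [|i] z; [apply: dif0_dif | apply: dif_dif]. Qed.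

(** The leading part of a cycle at each multichain of least size bounds in the
    Koszul complex. In degree 0 this is the computation of the colon ideal. *)
Lemma lead_bounds i k (z : free i) I :
    cycle z -> supp_ge k z -> is_multichain I -> chain_size I = k ->
  exists y, kchain (corners p I) i.+1 y /\
    forall s, kd (@enc r n) (@vidx r n) y s = coef z I s.
Proof.
case: i z => [|i] z dz zk HI Ik; last first.
  apply: (koszul_exact (@enc_inj r n) (@vidx_inj r n)) => [|s]; first exact: coef_kchain.
  have [Hs|Hs] := boolP (is_symbol K p i (s, I)).
    have := @dif_lead i k z (Sub (s, I) Hs) zk; rewrite /= Ik leqnn => /(_ isT).
    by rewrite dz ffunE => /eqP; rewrite eq_sym oppr_eq0 => /eqP.
  rewrite /kd big1 // => v vs.
  have [->|/coef_kchain[vsI]] := eqVneq (coef z I (v |: s)) 0; first exact: mulr0.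
  rewrite cardsU1 vs add1n => -[si]; case/negP: Hs; rewrite is_symbolE HI si eqxx andbT.
  by apply: subset_trans vsI; apply: subsetUr.
apply: koszul_exact0; first exact: coef_kchain.
apply/var_idealP => m ma.
have Hb : is_symbol K p 0 (set0, I) by rewrite is_symbolE HI sub0set cards0.
pose b : sym 0 := Sub (set0, I) Hb.
have zE : coef z I set0 * u K p I = - \sum_(b' | b' != b) z b' * u K p (val b').2.
  apply/eqP; rewrite -addr_eq0 /coef insubT -/b -[X in _ == X]dz; apply/eqP.
  by rewrite dif0E [RHS](bigD1 b).
have : (m + umon p I)%MM \in msupp (coef z I set0 * u K p I).
  by rewrite (perm_mem (msuppMX _ _)) addmC; apply: map_f.
rewrite zE (perm_mem (msuppN _)) => /msupp_sum_le/flatten_mapP[b'].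
rewrite mem_filter => /andP[b'b _] mb'.
have [HI' sI' si'] := symP b'.
have zb' : z b' != 0 by apply: contraTneq mb' => ->; rewrite mul0r msupp0.
have [|w wI Jw] := exists_corner p_bij p_label HI HI'.
  move=> sub; have := chain_size_sub _ sub; rewrite Ik zk // => /(_ isT) E.
  case/eqP: b'b; apply: val_inj; rewrite [val b']surjective_pairing E.
  by rewrite (cards0_eq si').
exists w => //; have := mulmx_msupp mb' => /mnm_lepP/(_ (vidx w)).
by rewrite Jw mnmDE umon_corner // addn0 -lt0n.
Qed.

Theorem cycle_exact i (z : free i) : cycle z -> exists y, z = dif i y.
Proof.
suff H d : forall k (z : free i), (r.+1 * #|P| < k + d)%N -> supp_ge k z -> cycle z ->
    exists y, z = dif i y.
  by move=> dz; apply: (H (r.+1 * #|P|).+1 0%N) => //; rewrite add0n.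
elim: d => [|d IH] k {}z; rewrite ?addn0 ?addnS => kb zk dz.
  exists 0; rewrite linear0; apply/ffunP => b; rewrite ffunE; apply/eqP.
  apply: contraLR kb => /zk; rewrite -leqNgt => le.
  exact: leq_trans le (chain_size_bound _).
have /choice[y yP] I : exists y : {set var} -> S,
    is_multichain I -> chain_size I = k -> kchain (corners p I) i.+1 y /\
      forall s, kd (@enc r n) (@vidx r n) y s = coef z I s.
  have [HI|] := boolP (is_multichain I); last by exists (fun=> 0).
  have [Ik|] := eqVneq (chain_size I) k; last by move/eqP=> h; exists (fun=> 0).
  by have [y Hy] := lead_bounds dz zk HI Ik; exists y.
pose Y : free i.+1 :=
  [ffun b => if chain_size (val b).2 == k then - y (val b).2 (val b).1 else 0].
have Yk : supp_ge k Y.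
  by move=> b; rewrite ffunE; case: (chain_size _ =P k) => [->//|_]; rewrite eqxx.
have [||| y' yE] := IH k.+1 (z - dif i Y).
- by rewrite addSn.
- move=> b; rewrite ltnNge; apply: contraNN => bk.
  have [HI sI si] := symP b.
  rewrite !ffunE (dif_lead Yk bk) opprK -coef_val.
  move: bk; rewrite leq_eqVlt => /orP[/eqP bk|bk].
    have [Hy Ey] := yP _ HI bk; rewrite -Ey addrC.
    rewrite addr_eq0; apply/eqP.
    rewrite -mulN1r -kdZ; apply: eq_bigr => v vs; congr (_ * _).
    rewrite /coef; case: insubP => [b2 _ E|h].
      by rewrite ffunE E /= bk eqxx mulN1r.
    have [->|/Hy[sub /eqP si2]] := eqVneq (y (val b).2 (v |: (val b).1)) 0; first by rewrite mulr0.
    by rewrite is_symbolE HI sub si2 in h.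
  rewrite coef_val (_ : z b = 0); last first.
    by apply/eqP; apply: contraLR bk => /zk; rewrite -leqNgt.
  rewrite add0r /kd big1 // => v vs; rewrite /coef; case: insubP => [b2 _ E|]; last by rewrite mulr0.
  by rewrite ffunE E /= ltn_eqF // mulr0.
- by apply: cycleB => //; apply: cycle_dif.
exists (Y + y'); rewrite linearD -yE addrC subrK //.
Qed.

End Complex.

(** * The complex is a graded minimal free resolution *)

Section Resolution.
Variables (K : fieldType) (r n : nat).
Variables (disp : Order.disp_t) (P : finPOrderType disp) (p : 'I_n -> P).
Hypotheses (n_ge1 : (1 <= n)%N) (r_ge1 : (1 <= r)%N) (p_bij : bijective p).
Hypothesis p_label : forall i j : 'I_n, (p i < p j)%O -> (i < j)%N.
Local Notation S := {mpoly K[r * n]}.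
Local Notation var := (var r n).
Local Notation chain := {ffun 'I_r.+1 -> {set P}}.
Local Notation piH := (pihomog [measure of mdeg]).
Local Notation sym i := {b : {set var} * chain | is_symbol K p i b}.
Local Notation free := (free K r p).
Implicit Types (I J : chain) (v w : var) (s t : {set var}).

Lemma is_gen_monomial (z : S^o) :
  is_gen p z <-> exists2 m,
    (exists2 I, is_multichain I & m = umon p I) & z = 'X_[m] :> S.
Proof.
split=> [[I HI ->]|[_ [I HI ->] ->]]; last by exists I.
by exists (umon p I) => //; exists I.
Qed.

(** The ideal H_r(P) is homogeneous. *)
Lemma pihomog_ideal k (q : S^o) :
  q \in lspan (is_gen p) -> (piH k q : S^o) \in lspan (is_gen p).
Proof.
move=> /(lspan_monomials _ is_gen_monomial) h.
apply/(lspan_monomials _ is_gen_monomial) => m mq; apply: h.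
have : (piH k (q : S))@_m != 0 by rewrite -mcoeff_msupp.
rewrite pihomogE raddf_sum /= mcoeff_msupp; apply: contraNneq => q0.
rewrite big1 // => m' _; rewrite mcoeffZ mcoeffX; case: eqP => [->|_]; last exact: mulr0.
by rewrite q0 mul0r.
Qed.

Lemma SmodHr_pi_linear : linear (SmodHr_pi K (r := r) p : S^o -> SmodHr K r p).
Proof. exact: lquot_pi_linear. Qed.

(** The augmentation S -> S/H_r(P) as a module map. *)
Definition aug : {linear S^o -> SmodHr K r p} :=
  HB.pack_for {linear S^o -> SmodHr K r p} (SmodHr_pi K (r := r) p : S^o -> SmodHr K r p)
    (GRing.isLinear.Build S S^o (SmodHr K r p) *:%R _ SmodHr_pi_linear).

Lemma aug_eq0 q : aug q = 0 <-> q \in lspan (is_gen p).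
Proof. exact: lquot_pi_eq0. Qed.

Lemma aug_onto (y : SmodHr K r p) : exists q, y = aug q.
Proof. by exists (repr y); rewrite -[LHS]reprK. Qed.

Lemma SmodHr_graded : exists c, graded_proj (SmodHr_gr K (r := r) p) c.
Proof.
have /choice[rp rpK] := aug_onto.
pose c k y := aug (piH k (rp y)).
have cE k q : c k (aug q) = aug (piH k q).
  apply/eqP; rewrite -subr_eq0 -linearB /= -pihomogB; apply/eqP/aug_eq0/pihomog_ideal/aug_eq0.
  by rewrite linearB -rpK subrr.
exists c; split.
- move=> k y z; have [[q ->] [q' ->]] := (aug_onto y, aug_onto z).
  by rewrite -linearD !cE pihomogD linearD.
- by move=> k y; exists (piH k (rp y)) => //; apply: pihomogP.
- by move=> k _ [q qk ->]; rewrite -[SmodHr_pi K (r := r) p q]/(aug q) cE pihomog_dE.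
- move=> j k _ [q qj ->] jk; rewrite -[SmodHr_pi K (r := r) p q]/(aug q) cE.
  by rewrite (pihomog_ne0 jk qj) linear0.
- move=> y; have [q ->] := aug_onto y; exists (msize q).
  rewrite {1}[q](pihomog_partitionE (mf := [measure of mdeg]) (leqnn (msize q))).
  by rewrite linear_sum; apply: eq_bigr => k _; rewrite cE.
Qed.

(** The modules, degrees and differentials of the resolution: S in homological
    degree 0 and the free module on the symbols with #|s| = j in degree j + 1. *)
Definition res_mod i : lmodType S := if i is j.+1 then free j else S^o.

Definition res_gr i : nat -> res_mod i -> Prop :=
  match i with
  | 0 => fun k (q : S) => q \is k.-homog
  | j.+1 => fun k (y : free j) => forall b : sym j,
      if (symbol_deg p (val b) <= k)%N
      then (y b : S) \is (k - symbol_deg p (val b)).-homog else y b == 0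
  end.

Definition res_d i : {linear res_mod i.+1 -> res_mod i} :=
  match i with 0 => dif0 K r p | j.+1 => dif K r p j end.

Definition res : augmented_complex (SmodHr K r p) :=
  @AugmentedComplex _ _ _ res_mod res_gr res_d aug.

Lemma res_basis0 : @is_basis K (r * n) S^o unit (fun=> 1 : S).
Proof.
have E (a : unit -> S) : \sum_b a b *: (1 : S^o) = a tt.
  by rewrite (big_pred1 tt) => [|[]//]; apply: mulr1.
by split=> [y|a a0 []]; [exists (fun=> y); rewrite E | rewrite -E].
Qed.

Lemma res_free i : graded_free (@res_gr i).
Proof.
case: i => [|i].
  exists unit, (fun=> 1 : S), (fun=> 0%N); split; first exact: res_basis0.
  move=> k y; split=> [yk|[a [Ha ->]]].
    exists (fun=> y); rewrite (big_pred1 tt) => [|[]//].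
    by split=> [_|]; [rewrite leq0n subn0 | rewrite [RHS]mulr1].
  rewrite (big_pred1 tt) => [|[]//]; have := Ha tt; rewrite leq0n subn0 => h.
  by rewrite [_ *: _]mulr1.
exists (sym i), (fun b => symb K p i (val b).1 (val b).2), (fun b => symbol_deg p (val b)).
split=> [|k y]; first exact: symb_basis.
split=> [yk|[a [Ha ->]] b]; last by rewrite free_sum.
by exists y; split=> //; apply/ffunP => b; rewrite free_sum.
Qed.

Lemma symb_gr i s I : @res_gr i.+1 (symbol_deg p (s, I)) (symb K p i s I).
Proof.
move=> b; rewrite ffunE; case: eqP => [->|_]; last by rewrite eqxx; case: ifP => // _; apply: dhomog0.
by rewrite leqnn subnn; apply: dhomog1.
Qed.

Lemma mdeg_umon_shift I v : is_multichain I -> v \in corners p I ->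
  mdeg (umon p (chain_shift p I v)) = mdeg (umon p I).
Proof.
move=> HI vI; have := congr1 mdeg (umon_shift p_bij v.1 HI vI).
by rewrite !mdegD !mdeg1 !addn1 => -[].
Qed.

Lemma homogX v : x K v \is 1.-homog.
Proof. by rewrite dhomogX; apply/eqP/mdeg1. Qed.

Lemma bd_gr i (b : sym i.+1) :
  @res_gr i.+1 (symbol_deg p (val b)) (bd p (symb K p i) (val b).1 (val b).2).
Proof.
have [HI sI si] := symP p_bij p_label b; set s := (val b).1; set I := (val b).2.
have [c Hc] := graded_free_proj (res_free i.+1).
rewrite /bd big_mkcond; apply: (gp_gr_sum Hc) => v; case: ifP => vs; last exact: gp_gr0 Hc _.
have deg1 J : mdeg (umon p J) = mdeg (umon p I) ->
    (1 + symbol_deg p (s :\ v, J))%N = symbol_deg p (val b).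
  by move=> E; rewrite /symbol_deg /= E addnA [#|s|](cardsD1 v) vs.
have sg k : (-1) ^+ k \is [in K[r * n], 0.-homog].
  have h1 : (-1 : S) \is 0.-homog by rewrite dhomogN; apply: dhomog1.
  by have := dhomogMn k h1; rewrite mul0n.
rewrite -[symbol_deg p (val b)]add0n.
apply: (graded_freeZ (res_free i.+1) (sg _)); apply: (gp_grB Hc).
  rewrite -(deg1 (chain_shift p I v)); last by rewrite mdeg_umon_shift ?(subsetP sI).
  exact: (graded_freeZ (res_free i.+1) (homogX _) (symb_gr _ (chain_shift p I v))).
rewrite -(deg1 I) //.
exact: (graded_freeZ (res_free i.+1) (homogX _) (symb_gr _ I)).
Qed.

Lemma res_d_gr i k y : res_gr k y -> res_gr k (res_d i y).
Proof.
case: i y => [|i] y yk.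
  rewrite [res_d 0 y]dif0E; apply: (graded_free_sum (res_free 0) _ yk) => b.
  have [_ _ /eqP] := symP p_bij p_label b.
  rewrite /symbol_deg => /eqP ->; rewrite add0n.
  by change (u K p (val b).2 \is (mdeg (umon p (val b).2)).-homog); rewrite dhomogX.
rewrite [res_d _ y]difE.
by apply: (graded_free_sum (res_free i.+1) _ yk) => b; apply: bd_gr.
Qed.

(** Since P is nonempty, no generator is 1, and the first differential is
    minimal. *)
Lemma umon_neq0 I : is_multichain I -> umon p I != 0%MM.
Proof.
move=> HI; have [i j] : 'I_r * 'I_n by split; [exists 0%N | exists 0%N].
apply/eqP => /mnmP/(_ (vidx (level_row p I i j, j))).
by rewrite mnm0E (umonE p i) // eqxx.
Qed.

Lemma res_minimal i y : res_d i y \in lspan (@irrelevant K (r * n) (res_mod i)).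
Proof.
case: i y => [|i] y.
  rewrite [res_d 0 y]dif0E; apply: rpred_sum => b _; apply: lspanZ; apply: lspan_gen.
  have [HI _ _] := symP p_bij p_label b.
  have /existsP[l ul] : [exists l, umon p (val b).2 l != 0%N].
    rewrite -negb_forall; apply: contra (umon_neq0 HI) => /forallP h.
    by apply/eqP/mnmP => l; rewrite mnm0E; apply/eqP.
  exists l, ('X_[umon p (val b).2 - U_(l)] : S^o).
  transitivity ('X_l * 'X_[umon p (val b).2 - U_(l)] : S); last by [].
  by rewrite -mpolyXD addmC submK // lep1mP.
rewrite [res_d _ y]difE; apply: rpred_sum => b _; apply: lspanZ.
apply: rpred_sum => v _; apply: lspanZ; apply: rpredB; apply: lspan_gen;
  by eexists; eexists.
Qed.

Lemma res_graded_minimal_free_resolution :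
  graded_minimal_free_resolution (SmodHr_gr K (r := r) p) res.
Proof.
split.
- exact: res_free.
- by split=> [k y yk|i k y]; [exists y | apply: res_d_gr].
- split=> [y|y]; first by have [q ->] := aug_onto y; exists q.
  have genE (z : S^o) : is_gen p z <->
      exists2 b : sym 0, xpredT b & z = (u K p (val b).2 : S^o).
    split=> [[I HI ->]|[b _ ->]]; last by have [HI _ _] := symP p_bij p_label b; exists (val b).2.
    have Hb : is_symbol K p 0 (set0, I).
      by rewrite (is_symbolE _ p_bij p_label) HI sub0set cards0.
    by exists (Sub (set0, I) Hb).
  split=> [/aug_eq0/(lspan_finP _ genE)[a ->]|[z ->]].
    by exists [ffun b => a b]; rewrite [RHS]dif0E; apply: eq_bigr => b _; rewrite ffunE.
  by apply/aug_eq0/(lspan_finP _ genE); exists z.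
- case=> [|i] y; split=> [h|[z ->]].
  + exact: (cycle_exact p_bij p_label (i := 0) h).
  + exact: dif0_dif.
  + exact: (cycle_exact p_bij p_label (i := i.+1) h).
  + exact: dif_dif.
- exact: res_minimal.
Qed.

End Resolution.

(** * The resolution of S/H_r(P) *)

Theorem theorem3p6 (K : fieldType) (r n : nat)
    (disp : Order.disp_t) (P : finPOrderType disp) (p : 'I_n -> P)
    (r_ge1 : (1 <= r)%N) (n_ge1 : (1 <= n)%N) (p_bij : bijective p)
    (p_label : forall i j : 'I_n, (p i < p j)%O -> (i < j)%N) :
  (exists F : augmented_complex (SmodHr K r p),
     graded_minimal_free_resolution (SmodHr_gr K p) F) /\
  (forall F : augmented_complex (SmodHr K r p),
     graded_minimal_free_resolution (SmodHr_gr K p) F ->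
     exists (e0 : cx_mod F 0)
            (f : forall i : nat, {set var r n} -> {ffun 'I_r.+1 -> {set P}} ->
                   cx_mod F i.+1),
       [/\ homogeneous_basis (@cx_gr _ _ _ F 0)
             (fun _ : unit => e0) (fun _ : unit => 0%N) /\
           cx_aug F e0 = SmodHr_pi K p 1,
           forall i : nat,
             homogeneous_basis (@cx_gr _ _ _ F i.+1)
               (fun b : {b : {set var r n} * {ffun 'I_r.+1 -> {set P}} |
                         is_symbol K p i b} => f i (val b).1 (val b).2)
               (fun b : {b : {set var r n} * {ffun 'I_r.+1 -> {set P}} |
                         is_symbol K p i b} => symbol_deg p (val b)),
           forall (i : nat) (s : {set var r n}) (I : {ffun 'I_r.+1 -> {set P}}),
             is_multichain I -> ~~ (s \subset set_u K p I) ->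
             f i s I = 0,
           forall I : {ffun 'I_r.+1 -> {set P}}, is_multichain I ->
             cx_d F 0 (f 0%N set0 I) = u K p I *: e0 &
           forall (i : nat) (s : {set var r n}) (I : {ffun 'I_r.+1 -> {set P}}),
             is_multichain I -> s \subset set_u K p I ->
             #|s| = i.+1 ->
             cx_d F i.+1 (f i.+1 s I) =
             \sum_(v in s) (-1) ^+ alpha s v *:
                (x K (level_row p I v.1 v.2, v.2)
                   *: f i (s :\ v) (chain_shift p I v)
                 - x K v *: f i (s :\ v) I)]).
Proof.
have resG := res_graded_minimal_free_resolution K n_ge1 r_ge1 p_bij p_label.
split=> [|F resF]; first by exists (res K r p).
have [phi [phi_bij phiH phi_aug phi_d]] :=
  minimal_resolution_unique (SmodHr_graded K r p) resF resG.
exists (phi 0%N (1 : {mpoly K[r * n]})), (fun i s I => phi i.+1 (symb K p i s I)).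
split.
- split; last by rewrite phi_aug.
  split; first exact: (basis_iso (@res_basis0 K r n) (phi_bij 0%N)).
  by move=> _; apply: phiH; apply: dhomog1.
- move=> i; split; first exact: (basis_iso (symb_basis K r p i) (phi_bij i.+1)).
  by move=> b; apply: phiH; rewrite [val b]surjective_pairing; apply: symb_gr.
- move=> i s I HI sI; rewrite symb_eq0 ?linear0 //.
  by rewrite /is_symbol /= (negPf sI) andbF.
- move=> I HI; rewrite phi_d.
  have -> : res_d K r p 0 (symb K p 0 set0 I) =
      (u K p I : {mpoly K[r * n]}) *: (1 : {mpoly K[r * n]}^o).
    rewrite [LHS]ext_symb (is_symbolE _ p_bij p_label) HI sub0set cards0 /=.
    by symmetry; apply: mulr1.
  exact: linearZ_LR.
- move=> i s I HI sI si; rewrite phi_d.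
  have -> : res_d K r p i.+1 (symb K p i.+1 s I) = bd p (symb K p i) s I.
    by rewrite [LHS]ext_symb /is_symbol HI sI si eqxx.
  exact: bd_linear.
Qed.
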